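(* Let $(q_n)$ be a sequence of positive integers with $q_n/n\to0$ and $q_n\asymp(\log n)^{\delta_2}$ for some $\delta_2>1$. Let $X_i=\theta_i+\epsilon_i$, $i=1,\dots,n$, with $\epsilon_i$ i.i.d. $N(0,1)$, and consider testing $H_{0i}:\theta_i=0$ against $H_{1i}:\theta_i\neq0$ simultaneously for $i=1,\dots,n$ with the empirical Bayes rule $\boldsymbol\psi=(\psi_1,\dots,\psi_n)$, $$\psi_i=\mathbf 1\Bigl\{\mathbb E(1-\kappa_i\mid X_i,\widehat\tau)>\tfrac12\Bigr\},\qquad \widehat\tau=\max\Bigl\{\frac1n,\ \frac1{c_2n}\sum_{j=1}^n\mathbf 1\bigl(|X_j|>\sqrt{c_1\log n}\bigr)\Bigr\},$$ where $c_1\ge2$ and $c_2\ge1$ are constants and $\mathbb E(1-\kappa_i\mid X_i,\widehat\tau)$ is the posterior shrinkage coefficient $\mathbb E(1-\kappa_i\mid X_i,\tau)$ (defined in the context) evaluated at $\tau=\widehat\tau$, computed under the one-group prior with exponent $a=\tfrac12$ and slowly varying function $L$. Assume that $L$ satisfies (A1) and (A2) of the context. Then for every fixed $b\in\mathbb R$, $$\frac1{q_n}\sup_{\boldsymbol\theta\in\boldsymbol\Theta_b}\mathbb E_{\boldsymbol\theta}\,\mathcal L(\boldsymbol\theta,\boldsymbol\psi)=1-\Phi(b)+o(1)\qquad (n\to\infty),$$ where $\mathcal L$ is the classification loss and $\boldsymbol\Theta_b$ the beta-min class defined in the context. The same conclusion holds with $b$ replaced by any real sequence $b=b_n\to\i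nfty$.
   Context: One-group shrinkage prior: given $\tau>0$, independently over $i$, $\theta_i\mid\lambda_i,\tau\sim N(0,\lambda_i^2\tau^2)$ and $\lambda_i^2$ has probability density $\pi_1(t)=K\,t^{-a-1}L(t)$ on $(0,\infty)$, where $a>0$, $L:(0,\infty)\to(0,\infty)$ is measurable, continuous and slowly varying (at infinity), and $K>0$ is the normalizing constant; $a$ and $L$ do not depend on $n$. (Horseshoe-type priors are those with $a=\tfrac12$.) Shrinkage coefficient: $\kappa_i=1/(1+\lambda_i^2\tau^2)$, and $\mathbb E(1-\kappa_i\mid X_i,\tau)$ denotes the posterior mean of $1-\kappa_i$ given $X_i$ under this prior and $X_i\mid\theta_i\sim N(\theta_i,1)$; explicitly $$\mathbb E(1-\kappa_i\mid X_i=x,\tau)=\frac{\int_0^\infty \frac{t\tau^2}{1+t\tau^2}(1+t\tau^2)^{-1/2}e^{-x^2/(2(1+t\tau^2))}\,t^{-a-1}L(t)\,dt}{\int_0^\infty (1+t\tau^2)^{-1/2}e^{-x^2/(2(1+t\tau^2))}\,t^{-a-1}L(t)\,dt}.$$ Assumptions on $L$: (A1) there exist $c_0>0$ and $t_0>0$ such that $L(t)\ge c_0$ for all $t\ge t_0$; (A2) there exists $M\in(0,\infty)$ such that $\sup_{t\in(0,\infty)}L(t)\le M$. Beta-min class: for real $b$ (possibly depending on $n$), $\boldsymbol\Theta_b=\{\boldsymbol\theta\in\mathbb R^n:\ |S_{\boldsymbol\theta}|=q_n,\ |\theta_i|\ge\sqrt{2\log(n/q_n)}+b\ \text{for all } i\in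 S_{\boldsymbol\theta}\}$, where $S_{\boldsymbol\theta}=\{i:\theta_i\ne0\}$. Classification (Hamming) loss: $\mathcal L(\boldsymbol\theta,\boldsymbol\psi)=\sum_{i=1}^n\bigl[\mathbf 1\{\theta_i=0,\psi_i\ne0\}+\mathbf 1\{\theta_i\ne0,\psi_i=0\}\bigr]$. $\mathbb E_{\boldsymbol\theta}$ is expectation when the true mean vector is the fixed vector $\boldsymbol\theta$. $\Phi$ is the standard normal distribution function. For sequences, $a_n\asymp b_n$ means $0<c\le a_n/b_n\le c'<\infty$ for some constants $c,c'$ and all sufficiently large $n$. *)

(* Defs.v *)
From HB Require Import structures.
From mathcomp Require Import all_boot all_order all_algebra.
From mathcomp Require Import all_classical all_reals all_analysis.

Set Implicit Arguments.
Unset Strict Implicit.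
Unset Printing Implicit Defensive.

Import Order.TTheory GRing.Theory Num.Theory.
Import numFieldNormedType.Exports.

Local Open Scope classical_set_scope.
Local Open Scope ring_scope.

(* Slow variation at infinity, for a function on (0, +oo) *)
Definition slowly_varying (R : realType) (L : R -> R) : Prop :=
  forall c : R, 0 < c -> L (c * t) / L t @[t --> +oo] --> (1 : R).

(* K t^(-a-1) L(t) is a probability density on (0, +oo); it is the prior
   density of lambda_i^2.  The function L is total, but only its values on
   (0, +oo) matter. *)
Record one_group_prior (R : realType) (K a : R) (L : R -> R) : Prop := {
  prior_norm_gt0 : 0 < K ;
  prior_exponent_gt0 : 0 < a ;
  prior_L_gt0 : forall t : R, 0 < t -> 0 < L t ;
  prior_L_measurable : measurable_fun (`]0, +oo[ : set R) L ;
  prior_L_continuous : forall t : R, 0 < t -> {for t, continuous L} ;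
  prior_L_slowly_varying : slowly_varying L ;
  prior_total_mass :
    (\int[lebesgue_measure]_(t in `]0%R, +oo[) (K * t `^ (- a - 1) * L t)%:E
       = 1)%E
}.

Section Shrinkage.
Variables (R : realType) (a : R) (L : R -> R) (tau : R).

(* kappa_i as a function of t = lambda_i^2 *)
Definition shrinkage (t : R) : R := 1 / (1 + t * tau ^+ 2).

(* Up to the factor (2 pi)^(-1/2), the density at x of X_i given
   lambda_i^2 = t and tau, i.e. of N(0, 1 + t tau^2), theta_i being
   integrated out. *)
Definition likelihood (x t : R) : R :=
  (1 + t * tau ^+ 2) `^ (- (1 / 2)) *
  expR (- (x ^+ 2 / (2 * (1 + t * tau ^+ 2)))).

(* E(1 - kappa_i | X_i = x, tau); the normalizing constants of the prior and
   of the likelihood cancel. *)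
Definition posterior_shrinkage (x : R) : R :=
  (\int[lebesgue_measure]_(t in `]0%R, +oo[)
     ((1 - shrinkage t) * likelihood x t * t `^ (- a - 1) * L t)) /
  (\int[lebesgue_measure]_(t in `]0%R, +oo[)
     (likelihood x t * t `^ (- a - 1) * L t)).

End Shrinkage.

Section Testing.
Variables (R : realType) (n : nat).

Definition tau_hat (c1 c2 : R) (X : 'rV[R]_n) : R :=
  Num.max (1 / n%:R)
    (1 / (c2 * n%:R) *
     \sum_(j < n) ((Num.sqrt (c1 * ln n%:R) < `|X 0 j|)%R)%:R).

(* [true] means that the hypothesis theta_i = 0 is rejected. *)
Definition eb_rule (a : R) (L : R -> R) (c1 c2 : R) (X : 'rV[R]_n) (i : 'I_n) :
  bool := 1 / 2 < posterior_shrinkage a L (tau_hat c1 c2 X) (X 0 i).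

Definition hamming_loss (theta : 'rV[R]_n) (psi : 'I_n -> bool) : nat :=
  \sum_(i < n) (((theta 0%R i == 0%R) && psi i) +
                 ((theta 0%R i != 0%R) && ~~ psi i)).

Definition beta_min (q : nat) (b : R) : set 'rV[R]_n :=
  [set theta | #|[set i | theta 0 i != 0]%SET| = q /\
     forall i, theta 0 i != 0 ->
       Num.sqrt (2 * ln (n%:R / q%:R)) + b <= `|theta 0 i|].

End Testing.

Section Model.
Variables (R : realType) (d : measure_display) (T : measurableType d).
Variables (P : probability T R) (n : nat).

Definition mutually_independent (Z : 'I_n -> {RV P >-> R}) : Prop :=
  forall (J : {set 'I_n}) (B : 'I_n -> set R),
    (forall i, measurable (B i)) ->
    P (\bigcap_(i in [set` J]) (Z i @^-1` B i)) =
    (\prod_(i in J) P (Z i @^-1` B i))%E.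

Definition standard_normal (Z : {RV P >-> R}) : Prop :=
  forall B : set R, measurable B -> distribution P Z B = normal_prob 0 1 B.

Definition observation (theta : 'rV[R]_n) (eps : 'I_n -> {RV P >-> R}) (w : T) :
  'rV[R]_n := \row_i (theta 0 i + eps i w).

Definition max_risk (eps : 'I_n -> {RV P >-> R})
    (psi : 'rV[R]_n -> 'I_n -> bool) (Theta : set 'rV[R]_n) : \bar R :=
  ereal_sup
    [set 'E_P[fun w =>
              (hamming_loss theta (psi (observation theta eps w)))%:R%R]%E
    | theta in Theta].

End Model.

Definition Phi (R : realType) (x : R) : R :=
  fine (normal_prob 0 1 (`]-oo, x] : set R)).

Definition asymp (R : realType) (u v : R^nat) : Prop :=
  exists c c' : R, 0 < c /\ \forall n \near \oo, c <= u n / v n <= c'.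

(* Main.v *)
Require Import Defs.
From HB Require Import structures.
From mathcomp Require Import all_boot all_order all_algebra.
From mathcomp Require Import all_classical all_reals all_analysis.
From mathcomp Require Import measurable_realfun ring lra.

(* Write s for the posterior mean of 1 - kappa given X_i = x, pi for the prior
   density of lambda_i^2, and m = sqrt (2 ln (n/q)).  Two bounds on s, valid for
   all 0 < tau <= 1, drive the proof.
   - s <= C tau exp (x^2/2), since the integral of (1 - kappa) pi is O(tau).
   - s > 1/2 as soon as x^2 >= C and tau exp (x^2/2) >= C x^2; this comes from
     the sign of the integral of (1 - 2 kappa) against the posterior weight.
   Always tau_hat >= 1/n, so the second bound rejects whenever
   |x| >= sqrt (2 ln n) + eta, which is at most m + 2 eta because
   ln q = o(sqrt (ln n)).  Outside an event G of probability O(n^-2) at most q of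
   the errors exceed sqrt (c1 ln n) (union bound over the subsets of size q + 1,
   using q >= 2 ln n), so tau_hat <= 2q/n there, and the first bound accepts
   whenever |x| <= sqrt (2 ln (n / (4 C q))), which is at least m - eta.
   Hence false positives number o(q) in expectation by Mills' inequality, while a
   signal of size at least m + b is missed with probability at most
   Phi (2 eta - b); a signal of size exactly m + b is missed with probability at
   least Phi (- b - eta) - o(1). *)

Set Implicit Arguments.
Unset Strict Implicit.
Unset Printing Implicit Defensive.

Import Order.TTheory GRing.Theory Num.Theory.
Import numFieldNormedType.Exports.

Local Open Scope classical_set_scope.
Local Open Scope ring_scope.

(** * Tail integrals *)

Section TailIntegrals.
Context {R : realType}.
Implicit Types f F : R -> R.

Lemma integral_tail f F (a l : R) :
  (forall x, a <= x -> 0 <= f x) ->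
  (forall x, a <= x -> {for x, continuous f}) ->
  (forall x, a <= x -> is_derive x 1 F (f x)) ->
  F x @[x --> +oo] --> l ->
  (\int[lebesgue_measure]_(x in `[a, +oo[) (f x)%:E = (l - F a)%:E)%E.
Proof.
move=> f0 cf dF Fl.
rewrite (@ge0_continuous_FTC2y _ f F a l)//.
- apply/continuous_within_itvcyP; split.
    by move=> x; rewrite in_itv/= andbT => /ltW; exact: cf.
  by apply: cvg_at_right_filter; exact: cf.
- by move=> x /ltW/dF ?; exact: ex_derive.
- apply: cvg_at_right_filter; apply: differentiable_continuous.
  by apply/derivable1_diffP; have ? := dF a (lexx a); exact: ex_derive.
- move=> x; rewrite in_itv/= andbT => /ltW/dF ?.
  by rewrite derive1E; exact: derive_val.
Qed.

Lemma integrable_tail f F (a l : R) :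
  (forall x, a <= x -> 0 <= f x) ->
  (forall x, a <= x -> {for x, continuous f}) ->
  (forall x, a <= x -> is_derive x 1 F (f x)) ->
  F x @[x --> +oo] --> l ->
  lebesgue_measure.-integrable `[a, +oo[ (EFin \o f).
Proof.
move=> f0 cf dF Fl; apply/integrableP; split.
  apply/measurable_EFinP.
  apply: subspace_continuous_measurable_fun => //.
  apply/continuous_within_itvcyP; split.
    by move=> x; rewrite in_itv/= andbT => /ltW; exact: cf.
  by apply: cvg_at_right_filter; exact: cf.
under eq_integral.
  move=> x; rewrite inE/= in_itv/= andbT => ax.
  rewrite ger0_norm ?f0//; over.
by rewrite (integral_tail f0 cf dF Fl) ltry.
Qed.

Lemma cvgy_powRN (p : R) : 0 < p -> x `^ (- p) @[x --> +oo] --> (0 : R).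
Proof.
move=> p0; apply/cvgrPdist_le => e e0; near=> x.
have x0 : 0 < x by near: x; exact: nbhs_pinfty_gt.
rewrite sub0r normrN ger0_norm ?powR_ge0//.
(* Writing e as a power with exponent -p shows that x >= e^(-1/p) suffices. *)
have -> : e = (e `^ (- p^-1)) `^ (- p).
  by rewrite -powRrM mulrNN mulVf ?gt_eqF// powRr1 ?ltW.
rewrite powRN powRN lef_pV2 ?posrE ?powR_gt0//.
apply: ge0_ler_powR; rewrite ?nnegrE ?powR_ge0 ?ltW//.
Unshelve. all: by end_near. Qed.

Let is_derive_powR_half (x : R) : 0 < x ->
  is_derive x 1 (fun t : R => -2 * t `^ (- (1 / 2))) (x `^ (- (1 / 2) - 1)).
Proof.
move=> x0; have ? := is_derive1_powR (- (1 / 2)) x0.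
apply: is_derive_eq; rewrite /GRing.scale/=; lra.
Qed.

Let continuous_powR (p x : R) : 0 < x ->
  {for x, continuous (fun t : R => t `^ p)}.
Proof.
move=> x0; have h := is_derive1_powR p x0.
by apply: differentiable_continuous; apply/derivable1_diffP; exact: ex_derive.
Qed.

Let cvg_powR_half : (fun t : R => -2 * t `^ (- (1 / 2))) x @[x --> +oo] --> (0 : R).
Proof.
rewrite -[X in _ --> X](mulr0 (-2)); apply: cvgMr; apply: cvgy_powRN; lra.
Qed.

Lemma integral_powR_tail (s : R) : 0 < s ->
  (\int[lebesgue_measure]_(x in `[s, +oo[) (x `^ (- (1 / 2) - 1))%:E =
   (2 * s `^ (- (1 / 2)))%:E)%E.
Proof.
move=> s0; rewrite (integral_tail _ _ _ cvg_powR_half).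
- by rewrite sub0r mulNr opprK.
- by move=> x _; exact: powR_ge0.
- by move=> x sx; apply: continuous_powR; exact: lt_le_trans sx.
- by move=> x sx; apply: is_derive_powR_half; exact: lt_le_trans sx.
Qed.

Lemma integrable_powR_tail (s : R) : 0 < s ->
  lebesgue_measure.-integrable `[s, +oo[ (fun x => (x `^ (- (1 / 2) - 1))%:E).
Proof.
move=> s0; apply: (integrable_tail _ _ _ cvg_powR_half).
- by move=> x _; exact: powR_ge0.
- by move=> x sx; apply: continuous_powR; exact: lt_le_trans sx.
- by move=> x sx; apply: is_derive_powR_half; exact: lt_le_trans sx.
Qed.

Variables (tau : R) (tau0 : 0 < tau).

(** [f] is (1 - kappa) t^(-3/2), since 1 - kappa = t tau^2 / (1 + t tau^2). The substitution u = tau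
    sqrt t integrates it and gives the arctangent in [F]. *)
Let f (t : R) := tau ^+ 2 * t `^ (1 / 2 - 1) / (1 + t * tau ^+ 2).
Let F (t : R) := 2 * tau * atan (tau * t `^ (1 / 2)).

Let f_ge0 x : 1 <= x -> 0 <= f x.
Proof.
move=> x1; have x0 : 0 <= x by rewrite (le_trans _ x1).
rewrite /f divr_ge0//; first by rewrite mulr_ge0 ?powR_ge0 ?sqr_ge0.
by rewrite addr_ge0// mulr_ge0 ?sqr_ge0.
Qed.

Let f_cont x : 1 <= x -> {for x, continuous f}.
Proof.
move=> x1; have x0 : 0 < x by rewrite (lt_le_trans _ x1).
apply: cvgM; first by apply: cvgMr; exact: continuous_powR.
apply: cvgV; first by rewrite gt_eqF// ltr_pwDl// mulr_ge0 ?sqr_ge0// ltW.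
by apply: cvgD; [exact: cvg_cst|apply: cvgMl; exact: cvg_id].
Qed.

Let F_derive (x : R) : 1 <= x -> is_derive x 1 F (f x).
Proof.
move=> x1; have x0 : 0 < x by rewrite (lt_le_trans _ x1).
have ? := is_derive1_powR (1 / 2) x0.
have h : is_derive x 1 (fun t : R => tau * t `^ (1 / 2)) (tau * (1 / 2 * x `^ (1 / 2 - 1))).
  by apply: is_derive_eq; rewrite /GRing.scale.
have ha : is_derive (tau * x `^ (1 / 2)) 1 (@atan R) (1 + (tau * x `^ (1 / 2)) ^+ 2)^-1.
  exact: is_derive1_atan.
have hc := @is_derive1_comp _ (@atan R) (fun t : R => tau * t `^ (1 / 2)) x _ _ ha h.
have sqE : (x `^ (1 / 2)) ^+ 2 = x.
  by rewrite -powR_mulrn ?powR_ge0// -powRrM divfK// powRr1// ltW.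
apply: is_derive_eq; rewrite /GRing.scale/= /f exprMn sqE.
rewrite [tau ^+ 2 * x]mulrC; field.
by rewrite gt_eqF// ltr_pwDl// mulr_ge0 ?sqr_ge0// ltW.
Qed.

Let F_cvg : F x @[x --> +oo] --> 2 * tau * (pi / 2).
Proof.
apply: cvgMr; apply: cvg_comp (@cvgy_atan R).
apply/gt0_cvgMry => //; apply/cvgryPge => A.
near=> x.
have A0 : 0 <= Num.max A 1 by rewrite le_max ler01 orbT.
apply: (@le_trans _ _ ((Num.max A 1 ^+ 2) `^ (1 / 2))).
  rewrite -powR_mulrn// -powRrM (_ : 2%:R * (1 / 2) = 1) ?powRr1//; last lra.
  by rewrite le_max lexx.
apply: ge0_ler_powR; rewrite ?nnegrE ?sqr_ge0//.
Unshelve. all: by end_near. Qed.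

(** The integral equals 2 tau (pi/2 - atan tau): for a = 1/2 the tail of the prior contributes to
    the mean of 1 - kappa at the order of tau itself. *)
Lemma integral_shrinkage_tail :
  (\int[lebesgue_measure]_(t in `[1%R, +oo[)
    (tau ^+ 2 * t `^ (1 / 2 - 1) / (1 + t * tau ^+ 2))%:E <= (pi * tau)%:E)%E.
Proof.
rewrite (integral_tail f_ge0 f_cont F_derive F_cvg) lee_fin /F.
have /le_atan : 0 <= tau * 1 `^ (1 / 2) by rewrite mulr_ge0 ?powR_ge0 ?ltW.
rewrite atan0 => /(mulr_ge0 (ltW tau0)) h; lra.
Qed.

Lemma integrable_shrinkage_tail :
  lebesgue_measure.-integrable `[1, +oo[
    (fun t => (tau ^+ 2 * t `^ (1 / 2 - 1) / (1 + t * tau ^+ 2))%:E).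
Proof. exact: (integrable_tail f_ge0 f_cont F_derive F_cvg). Qed.

End TailIntegrals.

(** * The posterior shrinkage coefficient *)

Section PriorIntegrals.
Context {R : realType}.
Variables (K : R) (L : R -> R).
Hypothesis prior : one_group_prior K (1 / 2) L.

Local Notation mu := (@lebesgue_measure R).
Local Notation D := (`]0%R, +oo[%classic : set R).
Local Notation pw := (fun t : R => t `^ (- (1 / 2) - 1) * L t).

Let K_gt0 : 0 < K := prior_norm_gt0 prior.

Let pw_ge0 (t : R) : 0 < t -> 0 <= pw t.
Proof. by move=> t0; rewrite mulr_ge0 ?powR_ge0// ltW// (prior_L_gt0 prior). Qed.

Let measurable_pw : measurable_fun D pw.
Proof.
apply: measurable_funM; last exact: prior_L_measurable prior.
by apply: measurable_funTS; exact: measurable_powR.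
Qed.

Let integral_pw : (\int[mu]_(t in D) (pw t)%:E = K^-1%:E)%E.
Proof.
have <- : (K^-1%:E * \int[mu]_(t in D) (K * t `^ (- (1 / 2) - 1) * L t)%:E =
    K^-1%:E)%E by rewrite (prior_total_mass prior) mule1.
rewrite -ge0_integralZl//=.
- apply: eq_integral => t _; rewrite -EFinM; congr (_%:E).
  by rewrite -!mulrA mulKf// gt_eqF.
- apply/measurable_EFinP.
  rewrite (_ : (fun _ => _) = (cst K \* pw)).
    exact: measurable_funM.
  by apply/funext => t; rewrite /= mulrA.
- move=> t; rewrite /= in_itv/= andbT => /pw_ge0 h.
  by rewrite lee_fin -mulrA mulr_ge0// ltW.
- by rewrite lee_fin invr_ge0 ltW.
Qed.

Let integrable_pw : mu.-integrable D (EFin \o pw).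
Proof.
apply/integrableP; split; first exact/measurable_EFinP.
under eq_integral.
  move=> t; rewrite inE/= in_itv/= andbT => /pw_ge0 h.
  rewrite ger0_norm//; over.
by rewrite integral_pw ltry.
Qed.

Lemma integrable_bounded_prior (h : R -> R) : measurable_fun D h ->
  (forall t : R, 0 < t -> `|h t| <= 1) ->
  mu.-integrable D (EFin \o (fun t => h t * pw t)).
Proof.
move=> mh h1; apply: (le_integrable _ _ _ integrable_pw) => //.
  by apply/measurable_EFinP; exact: measurable_funM.
move=> t; rewrite /= in_itv/= andbT => t0.
rewrite lee_fin normrM (ger0_norm (pw_ge0 t0)).
by rewrite ler_piMl// ?pw_ge0// h1.
Qed.

Lemma Rintegral_ge_itv (f : R -> R) (a b c : R) : 0 < a -> a <= b -> 0 <= c ->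
  mu.-integrable D (EFin \o f) -> (forall t : R, 0 < t -> 0 <= f t) ->
  (forall t, a <= t <= b -> c <= f t) ->
  c * (b - a) <= \int[mu]_(t in D) f t.
Proof.
move=> a0 ab c0 fi f0 cf.
have sub : `[a, b]%classic `<=` D.
  move=> t /=; rewrite !in_itv/= andbT => /andP[+ _]; exact: lt_le_trans.
have mf := measurable_int _ fi.
rewrite /Rintegral -lee_fin fineK; last exact: integrable_fin_num.
apply: (@le_trans _ _ (\int[mu]_(t in `[a, b]) (f t)%:E)%E); last first.
  apply: ge0_subset_integral => // t /=; rewrite in_itv/= andbT => /f0.
  by rewrite lee_fin.
apply: (@le_trans _ _ (\int[mu]_(t in `[a, b]) c%:E)%E).
  rewrite integral_cst//= lebesgue_measure_itv/= lte_fin.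
  case: ltP => [_|ba]; first by rewrite -EFinB -EFinM.
  have -> : b = a by apply/eqP; rewrite eq_le ba ab.
  by rewrite subrr mulr0 mule0.
by apply: ge0_le_integral => //; exact: measurable_funS mf.
Qed.

(** Near 0 a constant bound on L would not help, since t^(-3/2) is not integrable there. Below s the
    total mass 1/K of [pw] is used instead, and beyond s an explicit dominating function. *)
Lemma Rintegral_le_split (f g : R -> R) (s c : R) : 0 < s -> 0 <= c ->
  mu.-integrable D (EFin \o f) ->
  mu.-integrable `[s, +oo[ (EFin \o g) ->
  (forall t : R, 0 < t -> t < s -> f t <= c * pw t) ->
  (forall t, s <= t -> f t <= g t) ->
  \int[mu]_(t in D) f t <= c / K + \int[mu]_(t in `[s, +oo[) g t.
Proof.
move=> s0 c0 fi gi fc fg.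
have DE : D = `]0, s[%classic `|` `[s, +oo[%classic.
  by rewrite -itv_bndbnd_setU// bnd_simp ltW.
have subl : `]0, s[%classic `<=` D by rewrite [X in _ `<=` X]DE; exact: subsetUl.
have subr : `[s, +oo[%classic `<=` D by rewrite [X in _ `<=` X]DE; exact: subsetUr.
have mpw : mu.-integrable `]0, s[ (EFin \o pw).
  exact: integrableS integrable_pw.
rewrite [X in Rintegral _ X]DE Rintegral_setU//; last first.
- apply/disj_setPS => t [/=]; rewrite !in_itv/= => /andP[_ ts] /andP[st _].
  by move: ts; rewrite ltNge st.
- by rewrite -DE.
apply: lerD; last first.
  apply: le_Rintegral => //; first exact: integrableS fi.
  by move=> t /=; rewrite in_itv/= andbT => /fg.
apply: (@le_trans _ _ (\int[mu]_(t in `]0, s[) (c * pw t))).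
  apply: le_Rintegral => //; first exact: integrableS fi.
    by apply: (@integrableZl _ _ _ mu _ _ c (EFin \o pw)).
  by move=> t /=; rewrite in_itv/= => /andP[]; exact: fc.
rewrite RintegralZl//; apply: ler_wpM2l => //.
rewrite -lee_fin /Rintegral fineK; last exact: integrable_fin_num.
rewrite -integral_pw; apply: ge0_subset_integral => //.
  exact/measurable_EFinP.
by move=> t /=; rewrite in_itv/= andbT => /pw_ge0; rewrite lee_fin.
Qed.

End PriorIntegrals.

Lemma ler_powRN {R : realType} (p x y : R) : 0 <= p -> 0 < x -> x <= y ->
  y `^ (- p) <= x `^ (- p).
Proof.
move=> p0 x0 xy; have y0 : 0 < y by exact: lt_le_trans xy.
rewrite !powRN lef_pV2 ?posrE ?powR_gt0//.
by apply: ge0_ler_powR; rewrite // nnegrE ltW.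
Qed.

(** * Upper bound and rejection criterion for the posterior mean of 1 - kappa *)

Section PosteriorBounds.
Context {R : realType}.

Local Notation mu := (@lebesgue_measure R).
Local Notation D := (`]0%R, +oo[%classic : set R).

Lemma shrinkage_gt0 (tau t : R) : 0 <= t -> 0 < shrinkage tau t.
Proof. by move=> t0; rewrite /shrinkage divr_gt0// ltr_pwDl// mulr_ge0 ?sqr_ge0. Qed.

Lemma shrinkage_le1 (tau t : R) : 0 <= t -> shrinkage tau t <= 1.
Proof.
move=> t0; have h : 0 <= t * tau ^+ 2 by rewrite mulr_ge0 ?sqr_ge0.
by rewrite /shrinkage ler_pdivrMr ?mul1r ?lerDl// ltr_pwDl.
Qed.

Let shrinkage_powR (tau t : R) : 0 <= t ->
  shrinkage tau t = (1 + t * tau ^+ 2) `^ (- 1).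
Proof.
by move=> t0; rewrite powR_inv1 /shrinkage ?div1r// addr_ge0// mulr_ge0 ?sqr_ge0.
Qed.

Let measurable_fun_powR (p : R) (f : R -> R) :
  measurable_fun D f -> measurable_fun D (fun t => f t `^ p).
Proof. by move=> mf; exact: (measurableT_comp (@measurable_powR R p) mf). Qed.

Lemma measurable_shrinkage (tau : R) : measurable_fun D (shrinkage tau).
Proof.
apply: (@eq_measurable_fun _ _ (measurableTypeR R) (measurableTypeR R) _
  (fun t : R => (1 + t * tau ^+ 2) `^ (- 1))).
  by move=> t; rewrite inE/= in_itv/= andbT => /ltW/shrinkage_powR.
apply: measurable_fun_powR; apply: measurable_funD => //.
exact: measurable_funM.
Qed.

Lemma likelihoodE (tau x t : R) : 0 <= t ->
  likelihood tau x t =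
  shrinkage tau t `^ (1 / 2) * expR (- (shrinkage tau t * (x ^+ 2 / 2))).
Proof.
move=> t0; rewrite /likelihood shrinkage_powR// -powRrM mulN1r -shrinkage_powR//.
rewrite /shrinkage; congr (_ * expR _); field.
by rewrite gt_eqF// ltr_pwDl// mulr_ge0 ?sqr_ge0.
Qed.

Lemma likelihood_ge0 (tau x t : R) : 0 <= likelihood tau x t.
Proof. by rewrite /likelihood mulr_ge0 ?powR_ge0 ?expR_ge0. Qed.

Lemma likelihood_le_exp (tau x t r : R) : 0 <= t ->
  r <= shrinkage tau t * (x ^+ 2 / 2) -> likelihood tau x t <= expR (- r).
Proof.
move=> t0 hr; rewrite likelihoodE//.
rewrite -[leRHS]mul1r ler_pM ?powR_ge0 ?expR_ge0//; last by rewrite ler_expR lerN2.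
rewrite -[leRHS](powRr0 (shrinkage tau t)); apply: ger_powR; last by lra.
by rewrite shrinkage_gt0// shrinkage_le1.
Qed.

Lemma likelihood_le1 (tau x t : R) : 0 <= t -> likelihood tau x t <= 1.
Proof.
move=> t0; rewrite -[leRHS]expR0 -oppr0; apply: likelihood_le_exp => //.
by apply: mulr_ge0; [rewrite ltW// shrinkage_gt0|rewrite divr_ge0 ?sqr_ge0].
Qed.

Lemma measurable_likelihood (tau x : R) : measurable_fun D (likelihood tau x).
Proof.
apply: (@eq_measurable_fun _ _ (measurableTypeR R) (measurableTypeR R) _
  (fun t : R => shrinkage tau t `^ (1 / 2) *
     expR (- (shrinkage tau t * (x ^+ 2 / 2))))).
  by move=> t; rewrite inE/= in_itv/= andbT => /ltW/likelihoodE ->.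
have ms := measurable_shrinkage tau.
apply: measurable_funM; first exact: measurable_fun_powR.
apply: measurableT_comp => //; apply: measurable_funN.
exact: measurable_funM.
Qed.

Variables (K : R) (L : R -> R).
Hypothesis prior : one_group_prior K (1 / 2) L.
Variables (c0 t0 M : R).
Hypotheses (c0_gt0 : 0 < c0) (t0_gt0 : 0 < t0).
Hypothesis L_ge : forall t : R, t0 <= t -> c0 <= L t.
Hypotheses (M_gt0 : 0 < M) (L_le : forall t : R, 0 < t -> L t <= M).

Let K_gt0 : 0 < K := prior_norm_gt0 prior.
Let L_ge0 (t : R) : 0 < t -> 0 <= L t.
Proof. by move=> ?; rewrite ltW// (prior_L_gt0 prior). Qed.

(** Integrand of the unnormalized posterior mean of h. The numerator, the denominator and both parts
    of 1 - 2 kappa are instances, so that one integrability proof serves all four. *)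
Let post (tau x : R) (h : R -> R) (t : R) :=
  h t * likelihood tau x t * t `^ (- (1 / 2) - 1) * L t.

Let posterior_shrinkageE (tau x : R) : posterior_shrinkage (1 / 2) L tau x =
  (\int[mu]_(t in D) post tau x (fun t => 1 - shrinkage tau t) t) /
  (\int[mu]_(t in D) post tau x (fun=> 1) t).
Proof.
suff -> : post tau x (fun=> 1) =
  (fun t : R => likelihood tau x t * t `^ (- (1 / 2) - 1) * L t) by [].
by apply/funext => t; rewrite /post [1 * likelihood _ _ _]mul1r.
Qed.

Let post_ge0 (tau x : R) (h : R -> R) (t : R) : 0 < t -> 0 <= h t -> 0 <= post tau x h t.
Proof. by move=> *; rewrite /post !mulr_ge0 ?likelihood_ge0 ?powR_ge0 ?L_ge0. Qed.

Let integrable_post (tau x : R) (h : R -> R) : measurable_fun D h ->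
  (forall t : R, 0 < t -> `|h t| <= 1) -> mu.-integrable D (EFin \o post tau x h).
Proof.
move=> mh h1.
have -> : post tau x h = fun t => (h t * likelihood tau x t) * (t `^ (- (1 / 2) - 1) * L t).
  by apply/funext => t; rewrite /post !mulrA.
apply: (integrable_bounded_prior prior).
  by apply: measurable_funM => //; exact: measurable_likelihood.
move=> t tt0; rewrite normrM (ger0_norm (likelihood_ge0 _ _ _)).
by rewrite mulr_ile1 ?likelihood_ge0 ?likelihood_le1 ?h1// ltW.
Qed.

Let integrable_num (tau x : R) :
  mu.-integrable D (EFin \o post tau x (fun t => 1 - shrinkage tau t)).
Proof.
apply: integrable_post.
  by apply: measurable_funB => //; exact: measurable_shrinkage.
move=> t /ltW tt0; have := shrinkage_gt0 tau tt0; have := shrinkage_le1 tau tt0.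
by move=> *; rewrite ger0_norm; lra.
Qed.

Let integrable_den (tau x : R) : mu.-integrable D (EFin \o post tau x (fun=> 1)).
Proof. by apply: integrable_post => // t _; rewrite normr1. Qed.

(** Only [t0, t0 + 1] is kept, where (A1) bounds L from below. As tau <= 1, the variance 1 + t tau^2
    lies between 1 and t0 + 2 there. *)
Let den_ge (tau x : R) : 0 < tau <= 1 ->
  (t0 + 2) `^ (- (1 / 2)) * (t0 + 1) `^ (- (1 / 2) - 1) * c0 * expR (- (x ^+ 2 / 2)) <=
  \int[mu]_(t in D) post tau x (fun=> 1) t.
Proof.
move=> /andP[tau0 tau1].
rewrite -[leLHS]mulr1 -[X in _ * X <= _](_ : (t0 + 1) - t0 = 1); last lra.
apply: Rintegral_ge_itv => //.
- lra.
- by rewrite !mulr_ge0 ?powR_ge0 ?expR_ge0 ?ltW.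
- by move=> t tt0; exact: post_ge0.
move=> t /andP[t0t tt1]; have tt0 : 0 < t by exact: lt_le_trans t0t.
have tau2 : tau ^+ 2 <= 1 by rewrite expr_le1// ltW.
have tau2t : t * tau ^+ 2 <= t by rewrite ler_piMr// ltW.
have tau2t0 : 0 <= t * tau ^+ 2 by rewrite mulr_ge0 ?sqr_ge0 ?ltW.
rewrite /post /likelihood [1 * (_ * expR _)]mul1r.
rewrite [leLHS](_ : _ = (t0 + 2) `^ (- (1 / 2)) * expR (- (x ^+ 2 / 2)) *
  (t0 + 1) `^ (- (1 / 2) - 1) * c0); last by ring.
apply: ler_pM; [| |apply: ler_pM; [| |apply: ler_pM|]|exact: L_ge];
  rewrite ?mulr_ge0 ?powR_ge0 ?expR_ge0 ?(ltW c0_gt0)//.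
- apply: ler_powRN; lra.
- rewrite ler_expR lerN2 ler_pdivrMr; last lra.
  have : 0 <= x ^+ 2 * (t * tau ^+ 2) by rewrite mulr_ge0 ?sqr_ge0.
  lra.
- rewrite -opprD; apply: ler_powRN; lra.
Qed.

Let integrableM_tail (c s : R) (g : R -> R) :
  mu.-integrable `[s, +oo[ (fun t => (g t)%:E) ->
  mu.-integrable `[s, +oo[ (EFin \o (fun t => c * g t)).
Proof. by move=> ig; apply: (@integrableZl _ _ _ mu _ _ c (EFin \o g)). Qed.

(** The likelihood is bounded by 1. On (0, 1) one has 1 - kappa <= tau^2, which meets the mass 1/K;
    on [1, +oo) L <= M leaves the arctangent integral, at most pi tau. Finally tau^2 <= tau. *)
Let num_le (tau x : R) : 0 < tau <= 1 ->
  \int[mu]_(t in D) post tau x (fun t => 1 - shrinkage tau t) t <=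
  (K^-1 + M * pi) * tau.
Proof.
move=> /andP[tau0 tau1].
have ig := integrable_shrinkage_tail tau0.
apply: le_trans (Rintegral_le_split prior (g := fun t => M *
   (tau ^+ 2 * t `^ (1 / 2 - 1) / (1 + t * tau ^+ 2))) (s := 1) (c := tau ^+ 2)
   _ _ _ _ _ _) _ => //.
- exact: sqr_ge0.
- exact: integrableM_tail.
- move=> t tt0 t1.
  have h0 : 0 <= t * tau ^+ 2 by rewrite mulr_ge0 ?sqr_ge0 ?ltW.
  rewrite /post -[leLHS]mulrA; apply: ler_wpM2r.
    by rewrite mulr_ge0 ?powR_ge0// L_ge0.
  apply: (@le_trans _ _ (1 - shrinkage tau t)).
    rewrite ler_piMr ?likelihood_le1 ?subr_ge0 ?shrinkage_le1//; exact: ltW.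
  have -> : 1 - shrinkage tau t = t * tau ^+ 2 / (1 + t * tau ^+ 2).
    by rewrite /shrinkage; field; lra.
  rewrite ler_pdivrMr; last lra.
  have : t * tau ^+ 2 <= tau ^+ 2 by rewrite ler_piMl ?sqr_ge0// ltW.
  have : 0 <= tau ^+ 2 * (t * tau ^+ 2) by rewrite mulr_ge0 ?sqr_ge0.
  lra.
- move=> t t1; have tt0 : 0 < t by lra.
  have h0 : 0 <= t * tau ^+ 2 by rewrite mulr_ge0 ?sqr_ge0 ?ltW.
  have -> : tau ^+ 2 * t `^ (1 / 2 - 1) / (1 + t * tau ^+ 2) =
      (1 - shrinkage tau t) * t `^ (- (1 / 2) - 1).
    have -> : 1 / 2 - 1 = 1 + (- (1 / 2) - 1) :> R by lra.
    rewrite [t `^ (1 + _)]powRD; last by rewrite (gt_eqF tt0) implybT.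
    rewrite powRr1 ?ltW//.
    by rewrite /shrinkage; field; lra.
  rewrite /post [leRHS]mulrC; apply: ler_pM; rewrite ?L_ge0 ?L_le//.
    rewrite !mulr_ge0 ?powR_ge0 ?likelihood_ge0//.
    by rewrite subr_ge0 shrinkage_le1 ?ltW.
  apply: ler_wpM2r; first exact: powR_ge0.
  rewrite ler_piMr ?likelihood_le1 ?subr_ge0 ?shrinkage_le1//; exact: ltW.
rewrite RintegralZl// [leRHS]mulrDl; apply: lerD.
  by rewrite mulrC ler_pM2l ?invr_gt0// expr2 ler_piMl// ltW.
rewrite -mulrA ler_pM2l// -lee_fin /Rintegral fineK; last first.
  exact: integrable_fin_num ig.
exact: integral_shrinkage_tail.
Qed.

(** Quotient of [num_le] by [den_ge]; the factor exp (x^2/2) comes from the denominator alone. *)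
Lemma posterior_shrinkage_le : exists2 C : R, 0 < C &
  forall tau x : R, 0 < tau <= 1 ->
    posterior_shrinkage (1 / 2) L tau x <= C * tau * expR (x ^+ 2 / 2).
Proof.
pose cd := (t0 + 2) `^ (- (1 / 2)) * (t0 + 1) `^ (- (1 / 2) - 1) * c0.
have cd0 : 0 < cd by rewrite !mulr_gt0 ?powR_gt0 ?addr_gt0.
have Cn0 : 0 < K^-1 + M * pi by rewrite addr_gt0 ?invr_gt0 ?mulr_gt0 ?pi_gt0.
exists ((K^-1 + M * pi) / cd); first exact: divr_gt0.
move=> tau x tau01; have [tau0 _] := andP tau01.
have hd := den_ge x tau01; have hn := num_le x tau01.
have d0 : 0 < cd * expR (- (x ^+ 2 / 2)) by rewrite mulr_gt0 ?expR_gt0.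
rewrite posterior_shrinkageE.
rewrite ler_pdivrMr; last exact: lt_le_trans hd.
apply: (le_trans hn); apply: le_trans (ler_wpM2l _ hd); last first.
  by rewrite !mulr_ge0 ?expR_ge0 ?(ltW tau0) ?(ltW Cn0)// invr_ge0 ltW.
rewrite -/cd expRN le_eqVlt; apply/orP; left; apply/eqP; field.
by rewrite (gt_eqF cd0) (gt_eqF K_gt0) gt_eqF ?expR_gt0.
Qed.

(** Positive and negative parts of 1 - 2 kappa, the quantity whose posterior sign decides the
    test. *)
Let pos (tau t : R) := Num.max (1 - 2 * shrinkage tau t) 0.
Let neg (tau t : R) := Num.max (2 * shrinkage tau t - 1) 0.

Let pos_ge0 (tau t : R) : 0 <= pos tau t.
Proof. by rewrite /pos le_max lexx orbT. Qed.

Let neg_ge0 (tau t : R) : 0 <= neg tau t.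
Proof. by rewrite /neg le_max lexx orbT. Qed.

Let pos_le1 (tau t : R) : 0 < t -> pos tau t <= 1.
Proof.
by move=> /ltW tt0; rewrite /pos ge_max; have := shrinkage_gt0 tau tt0; lra.
Qed.

Let neg_le1 (tau t : R) : 0 < t -> neg tau t <= 1.
Proof.
by move=> /ltW tt0; rewrite /neg ge_max; have := shrinkage_le1 tau tt0; lra.
Qed.

Let integrable_pos (tau x : R) : mu.-integrable D (EFin \o post tau x (pos tau)).
Proof.
apply: integrable_post => [|t tt0]; last by rewrite ger0_norm ?pos_ge0 ?pos_le1.
apply: measurable_maxr => //; apply: measurable_funB => //.
by apply: measurable_funM => //; exact: measurable_shrinkage.
Qed.

Let integrable_neg (tau x : R) : mu.-integrable D (EFin \o post tau x (neg tau)).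
Proof.
apply: integrable_post => [|t tt0]; last by rewrite ger0_norm ?neg_ge0 ?neg_le1.
apply: measurable_maxr => //; apply: measurable_funB => //.
by apply: measurable_funM => //; exact: measurable_shrinkage.
Qed.

(** Pointwise, 2 (1 - kappa) - 1 = [pos] - [neg]. Hence the posterior mean of 1 - kappa exceeds 1/2
    exactly when the weight of [pos] exceeds that of [neg]. *)
Let two_num (tau x : R) :
  2 * (\int[mu]_(t in D) post tau x (fun t => 1 - shrinkage tau t) t) +
    \int[mu]_(t in D) post tau x (neg tau) t =
  \int[mu]_(t in D) post tau x (fun=> 1) t +
    \int[mu]_(t in D) post tau x (pos tau) t.
Proof.
rewrite -RintegralZl// -!RintegralD//; last first.
  by apply: (@integrableZl _ _ _ mu _ _ 2 (EFin \o post tau x (fun t => 1 - shrinkage tau t))).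
congr (Rintegral _ _ _); apply/funext => t; rewrite /post /pos /neg.
move: (likelihood tau x t) (t `^ _) (L t) (shrinkage tau t) => l p r k.
have E : 2 * (1 - k) + Num.max (2 * k - 1) 0 = 1 + Num.max (1 - 2 * k) 0.
  by case: (lerP (1 - 2 * k) 0); case: (lerP (2 * k - 1) 0); lra.
transitivity ((2 * (1 - k) + Num.max (2 * k - 1) 0) * l * p * r); first by ring.
by rewrite E; ring.
Qed.

(* On [x^2/tau^2, 2x^2/tau^2] the coefficient kappa is of order 1/x^2, so the
   likelihood there is not exponentially small. *)
Let pos_ge (tau x : R) : 0 < tau <= 1 -> 4 <= x ^+ 2 -> t0 <= x ^+ 2 ->
  expR (- (1 / 2)) * c0 / 12 * tau / x ^+ 2 <=
  \int[mu]_(t in D) post tau x (pos tau) t.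
Proof.
move=> /andP[tau0 tau1] x4 xt0.
set y := x ^+ 2 in x4 xt0 *.
have tau2 : 0 < tau ^+ 2 <= 1 by rewrite exprn_gt0//= expr_le1// ltW.
have y0 : 0 < y by lra.
have a0 : 0 < y / tau ^+ 2 by rewrite divr_gt0//; lra.
have ya : y <= y / tau ^+ 2.
  by rewrite ler_pdivlMr; [rewrite ler_piMr; lra|lra].
(* The product of four lower bounds on this interval: [pos] >= 1/2 because kappa <= 1/y <= 1/4; the
   likelihood, because 1 + t tau^2 <= 3 y and kappa y/2 <= 1/2; the power of t, because t <= 2 y /
   tau^2; and L >= c0. *)
pose c := 2^-1 * ((3 * y) `^ (- (1 / 2)) * expR (- (1 / 2))) *
  (2 * (y / tau ^+ 2)) `^ (- (1 / 2) - 1) * c0.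
apply: (@le_trans _ _ (c * (2 * (y / tau ^+ 2) - y / tau ^+ 2))); last first.
  apply: Rintegral_ge_itv => //.
  - lra.
  - by rewrite !mulr_ge0 ?powR_ge0 ?expR_ge0 ?(ltW c0_gt0).
  - by move=> t tt0; exact: post_ge0.
  move=> t /andP[ta tb]; have tt0 : 0 < t by lra.
  have tau20 : 0 < tau ^+ 2 by case/andP: tau2.
  have yt : y <= t * tau ^+ 2 by rewrite -ler_pdivrMr.
  have ty : t * tau ^+ 2 <= 2 * y by rewrite -ler_pdivlMr// -mulrA.
  have kle : shrinkage tau t <= 1 / y.
    by rewrite /shrinkage !div1r lef_pV2 ?posrE; lra.
  have y4 : 1 / y <= 1 / 4 by rewrite !div1r lef_pV2 ?posrE; lra.
  have tt0' := ltW tt0.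
  rewrite /post /c; apply: ler_pM; [| |apply: ler_pM; [| |apply: ler_pM|]|];
    rewrite ?mulr_ge0 ?powR_ge0 ?expR_ge0 ?(ltW c0_gt0)//.
  - by rewrite /pos le_max; apply/orP; left; lra.
  - rewrite likelihoodE//; apply: ler_pM; rewrite ?powR_ge0 ?expR_ge0//.
      rewrite shrinkage_powR// -powRrM mulN1r; apply: ler_powRN; lra.
    rewrite ler_expR lerN2 -/y.
    have : shrinkage tau t * (y / 2) <= 1 / y * (y / 2) by rewrite ler_wpM2r//; lra.
    have -> : 1 / y * (y / 2) = 1 / 2 by field; lra.
    by [].
  - rewrite -opprD; apply: ler_powRN; lra.
  - apply: L_ge; lra.
have -> : c * (2 * (y / tau ^+ 2) - y / tau ^+ 2) =
    expR (- (1 / 2)) * c0 / 4 *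
    ((3 * y) `^ (- (1 / 2)) * (2 * (y / tau ^+ 2)) `^ (- (1 / 2))).
  have -> : (2 * (y / tau ^+ 2)) `^ (- (1 / 2)) =
     2 * (y / tau ^+ 2) * (2 * (y / tau ^+ 2)) `^ (- (1 / 2) - 1).
    rewrite -[X in X * _ `^ _]powRr1; last lra.
    rewrite -powRD; first by congr (_ `^ _); lra.
    by rewrite (gt_eqF (_ : 0 < 2 * _)) ?implybT//; lra.
  rewrite /c; lra.
rewrite -powRM; [|lra|lra].
have -> : 3 * y * (2 * (y / tau ^+ 2)) = 6 * (y / tau) ^+ 2.
  by field; rewrite gt_eqF.
have yt0 : 0 <= y / tau by rewrite divr_ge0// ltW.
(* Replacing 6 by 9 makes the square root explicit; with the 4 above, this is the origin of the
   constant 12. *)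
have : (3 * (y / tau))^-1 <= (6 * (y / tau) ^+ 2) `^ (- (1 / 2)).
  have -> : (3 * (y / tau))^-1 = ((3 * (y / tau)) ^+ 2) `^ (- (1 / 2)).
    rewrite -powR_mulrn; last lra.
    by rewrite -powRrM (_ : 2%:R * - (1 / 2) = -1) ?powR_inv1//; lra.
  apply: ler_powRN; [lra| |].
    by rewrite mulr_gt0// exprn_gt0// divr_gt0.
  rewrite exprMn; have := sqr_ge0 (y / tau); lra.
have E0 : 0 < expR (- (1 / 2)) * c0 / 4 by rewrite divr_gt0// mulr_gt0// expR_gt0.
move=> /(ler_wpM2l (ltW E0)); apply: le_trans.
rewrite le_eqVlt; apply/orP; left; apply/eqP; field.
by rewrite (gt_eqF tau0) (gt_eqF y0).
Qed.

(** With y = x^2, split at t = 1/(y tau^2). Below, kappa >= y/(1 + y), so kappa y/2 >= (y - 1)/2 and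
    the prior has mass 1/K. Above, [neg] vanishes unless kappa > 1/2, where the likelihood is at
    most exp (-y/4); L <= M and the tail of t^(-3/2) give the rest. *)
Let neg_le (tau x : R) : 0 < tau <= 1 -> 4 <= x ^+ 2 ->
  \int[mu]_(t in D) post tau x (neg tau) t <=
  expR (1 / 2 - x ^+ 2 / 2) / K + 2 * M * tau * x ^+ 2 * expR (- (x ^+ 2 / 4)).
Proof.
move=> /andP[tau0 tau1] x4.
set y := x ^+ 2 in x4 *.
have y0 : 0 < y by lra.
have s0 : 0 < (y * tau ^+ 2)^-1 by rewrite invr_gt0 mulr_gt0// exprn_gt0.
have ig := integrable_powR_tail s0.
apply: le_trans (Rintegral_le_split prior (g := fun t =>
   M * expR (- (y / 4)) * t `^ (- (1 / 2) - 1)) (s := (y * tau ^+ 2)^-1)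
   (c := expR (1 / 2 - y / 2)) _ _ _ _ _ _) _ => //.
- exact: integrableM_tail.
- move=> t tt0 ts.
  rewrite /post -[leLHS]mulrA; apply: ler_wpM2r.
    by rewrite mulr_ge0 ?powR_ge0// L_ge0.
  have ty : t * tau ^+ 2 <= y^-1.
    rewrite -ler_pdivlMr ?exprn_gt0//; move: ts; rewrite invfM; exact: ltW.
  have lik : likelihood tau x t <= expR (1 / 2 - y / 2).
    rewrite -[1 / 2 - y / 2]opprK; apply: likelihood_le_exp; first exact: ltW.
    rewrite -/y opprB.
    have : y / (1 + y) <= shrinkage tau t.
      rewrite /shrinkage ler_pdivlMr; last first.
        by rewrite ltr_pwDl// mulr_ge0 ?sqr_ge0// ltW.
      rewrite mulrAC ler_pdivrMr; last lra.
      have : y * (t * tau ^+ 2) <= y * y^-1 by rewrite ler_pM2l.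
      rewrite divff ?gt_eqF//; lra.
    move=> /(ler_wpM2r (_ : 0 <= y / 2)) h; apply: le_trans (h _); last lra.
    by rewrite [leRHS]mulrAC ler_pdivlMr; lra.
  rewrite -[leRHS]mul1r ler_pM ?neg_le1 ?likelihood_ge0//.
- move=> t st; have tt0 : 0 < t by exact: lt_le_trans st.
  have pt0 := powR_ge0 t (- (1 / 2) - 1).
  rewrite /post mulrC -[leRHS]mulrA; apply: ler_pM; rewrite ?L_ge0 ?L_le//.
    by apply: mulr_ge0 => //; apply: mulr_ge0; [exact: neg_ge0|exact: likelihood_ge0].
  apply: ler_wpM2r => //.
  have [k2|k2] := leP (shrinkage tau t) (1 / 2).
    by rewrite /neg max_r ?mul0r ?expR_ge0//; lra.
  rewrite -[leRHS]mul1r ler_pM ?neg_le1 ?likelihood_ge0//.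
  apply: likelihood_le_exp; first exact: ltW.
  rewrite -/y; have : 1 / 2 * (y / 2) <= shrinkage tau t * (y / 2).
    by rewrite ler_wpM2r; lra.
  lra.
rewrite RintegralZl//; apply: lerD => //.
rewrite /Rintegral integral_powR_tail//=.
have -> : (y * tau ^+ 2)^-1 `^ (- (1 / 2)) = (y * tau ^+ 2) `^ (1 / 2).
  rewrite -powR_inv1; last by rewrite mulr_ge0 ?sqr_ge0// ltW.
  by rewrite -powRrM mulN1r opprK.
(* The left side is tau sqrt y, and y >= 1. *)
have : (y * tau ^+ 2) `^ (1 / 2) <= y * tau.
  have yt0 : 0 <= y * tau by rewrite mulr_ge0// ltW.
  have -> : y * tau = ((y * tau) ^+ 2) `^ (1 / 2).
    have e2 : 2%:R * (1 / 2) = 1 :> R by lra.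
    by rewrite -powR_mulrn// -powRrM e2 powRr1.
  apply: ge0_ler_powR; [lra| |by rewrite nnegrE sqr_ge0|].
    by rewrite nnegrE mulr_ge0 ?sqr_ge0// ltW.
  rewrite exprMn; apply: ler_wpM2r; first exact: sqr_ge0.
  by rewrite expr2 ler_peMl//; lra.
have E0 : 0 <= 2 * M * expR (- (y / 4)) by rewrite !mulr_ge0 ?expR_ge0// ltW.
move=> /(ler_wpM2l E0); lra.
Qed.

Lemma posterior_shrinkage_gt_half : exists2 C : R, 0 < C &
  forall tau x : R, 0 < tau <= 1 -> C <= x ^+ 2 ->
    C * x ^+ 2 <= tau * expR (x ^+ 2 / 2) ->
    1 / 2 < posterior_shrinkage (1 / 2) L tau x.
Proof.
pose c3 := expR (- (1 / 2)) * c0 / 12.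
have c30 : 0 < c3 by rewrite divr_gt0// mulr_gt0// expR_gt0.
(* The lower bound on [pos] is c3 tau / y. The first term in the bound on [neg] is below half of it
   as soon as tau exp (y/2) > C1 y. *)
pose C1 := 2 * expR (1 / 2) / (K * c3).
have C10 : 0 < C1 by rewrite divr_gt0 ?mulr_gt0 ?expR_gt0.
(* Since exp (y/4) >= (y/4)^3 / 6 = y^3 / 384, the second term is at most the other half once y >= 4
   * 384 M / c3, and 4 * 384 <= 40 * 40. *)
pose C2 := 40 * 40 * M / c3.
have C20 : 0 < C2 by rewrite divr_gt0// !mulr_gt0.
exists (4 + t0 + C1 + C2); first by rewrite !addr_gt0.
move=> tau x tau01 Cx Ctau; have [tau0 _] := andP tau01.
have tpos := t0_gt0.
rewrite posterior_shrinkageE.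
have hd := den_ge x tau01.
have d0 : 0 < \int[mu]_(t in D) post tau x (fun=> 1) t.
  apply: lt_le_trans hd; rewrite mulr_gt0 ?expR_gt0// !mulr_gt0 ?powR_gt0//.
    exact: addr_gt0.
  exact: addr_gt0.
rewrite ltr_pdivlMr//.
have tn := two_num tau x.
suff : \int[mu]_(t in D) post tau x (neg tau) t <
       \int[mu]_(t in D) post tau x (pos tau) t by lra.
have x4 : 4 <= x ^+ 2 by lra.
apply: le_lt_trans (neg_le tau01 x4) _.
apply: lt_le_trans (pos_ge tau01 x4 _); last lra.
rewrite -/c3; move: x4 Cx Ctau; move: (x ^+ 2) => y x4 Cx Ctau.
have y0 : 0 < y by lra.
have h1 : expR (1 / 2 - y / 2) / K < c3 * tau / y / 2.
  have -> : expR (1 / 2 - y / 2) = expR (1 / 2) / expR (y / 2).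
    by rewrite expRD expRN.
  have E0 := expR_gt0 (y / 2).
  have -> : expR (1 / 2) / expR (y / 2) / K = C1 * y * (c3 / (2 * y * expR (y / 2))).
    by rewrite /C1; field; rewrite (gt_eqF y0) (gt_eqF E0) (gt_eqF K_gt0) (gt_eqF c30).
  have -> : c3 * tau / y / 2 = tau * expR (y / 2) * (c3 / (2 * y * expR (y / 2))).
    by field; rewrite (gt_eqF y0) (gt_eqF E0).
  rewrite ltr_pM2r; last by rewrite divr_gt0// !mulr_gt0.
  apply: lt_le_trans Ctau; rewrite ltr_pM2r//; lra.
have h2 : 2 * M * tau * y * expR (- (y / 4)) <= c3 * tau / y / 2.
  have E0 := expR_gt0 (y / 4).
  have e3 : y ^+ 3 / 384 <= expR (y / 4).
    have := @expR_ge1Dxn R (y / 4) 2 _; rewrite divr_ge0 ?(ltW y0)//.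
    have -> : 3`!%:R = 6 :> R by [].
    rewrite (_ : (y / 4) ^+ 3 / 6 = y ^+ 3 / 384); last by field.
    by move=> /(_ isT); lra.
  have : 4 * M * y ^+ 2 <= c3 * expR (y / 4).
    apply: (@le_trans _ _ (c3 * (y ^+ 3 / 384))); last by rewrite ler_pM2l.
    have : C2 * y ^+ 2 <= y * y ^+ 2 by rewrite ler_wpM2r ?sqr_ge0//; lra.
    move=> /(ler_wpM2l (ltW c30)).
    have -> : c3 * (C2 * y ^+ 2) = 40 * 40 * M * y ^+ 2.
      by rewrite /C2; field; rewrite (gt_eqF c30).
    have My : 0 <= M * y ^+ 2 by rewrite mulr_ge0 ?sqr_ge0// ltW.
    by rewrite -exprS => h; lra.
  have F0 : 0 <= tau / (2 * y * expR (y / 4)).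
    by rewrite divr_ge0 ?mulr_ge0 ?(ltW tau0) ?(ltW y0) ?(ltW E0).
  move=> /(ler_wpM2r F0).
  have -> : 4 * M * y ^+ 2 * (tau / (2 * y * expR (y / 4))) =
      2 * M * tau * y * expR (- (y / 4)).
    by rewrite expRN; field; rewrite (gt_eqF y0) (gt_eqF E0).
  have -> // : c3 * expR (y / 4) * (tau / (2 * y * expR (y / 4))) = c3 * tau / y / 2.
    by field; rewrite (gt_eqF y0) (gt_eqF E0).
lra.
Qed.

End PosteriorBounds.

(** * Gaussian tails *)

Section Gaussian.
Context {R : realType}.

Local Notation np := (@normal_prob R 0 1).

Let normal_pdf01 (x : R) :
  normal_pdf 0 1 x = normal_peak 1 * expR (- (x ^+ 2 / 2)).
Proof.
by rewrite normal_pdfE ?oner_eq0// /normal_fun subr0 expr1n mulNr.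
Qed.

Let peak_le : normal_peak 1 <= 2^-1 :> R.
Proof.
rewrite /normal_peak expr1n mul1r lef_pV2 ?posrE//; last first.
  by rewrite sqrtr_gt0 mulrn_wgt0// pi_gt0.
rewrite -[leLHS]ger0_norm// -sqrtr_sqr ler_sqrt.
  have := @pi_ge2 R; lra.
by rewrite mulrn_wge0// pi_ge0.
Qed.

Lemma Phi_itv (x : R) : np `]-oo, x] = (Phi x)%:E.
Proof. by rewrite /Phi fineK// fin_num_measure. Qed.

Lemma normal_prob_itvcy (x : R) : np `[x, +oo[ = (Phi (- x))%:E.
Proof.
rewrite -Phi_itv /normal_prob ge0_integration_by_substitutionNy.
- by apply: eq_integral => t _; rewrite /= !normal_pdf01 sqrrN.
- by apply: continuous_subspaceT; apply: continuous_normal_pdf; rewrite oner_eq0.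
- by move=> t _; exact: normal_pdf_ge0.
Qed.

Lemma normal_prob_itvoy (x : R) : np `]x, +oo[ = (Phi (- x))%:E.
Proof.
rewrite -normal_prob_itvcy /normal_prob integral_itv_obnd_cbnd//.
by apply: measurable_funTS; apply/measurable_EFinP; exact: measurable_normal_pdf.
Qed.

Lemma PhiN (x : R) : Phi (- x) = 1 - Phi x.
Proof.
have : (np (~` `]-oo, x]) = 1 - np `]-oo, x])%E by exact: probability_setC.
by rewrite setCitvl normal_prob_itvoy Phi_itv -EFinB => -[].
Qed.

Lemma Phi_ge0 (x : R) : 0 <= Phi x.
Proof. by rewrite /Phi fine_ge0// measure_ge0. Qed.

Lemma Phi_mono (x y : R) : x <= y -> Phi x <= Phi y.
Proof.
by move=> xy; rewrite -lee_fin -!Phi_itv le_measure ?inE//; apply: subset_itvl.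
Qed.

(** The normal density is at most 1, so [Phi] is 1-Lipschitz. This turns an error in a threshold
    into an equal error in the risk. *)
Lemma Phi_shift (x h : R) : 0 <= h -> Phi (x + h) <= Phi x + h.
Proof.
move=> h0; rewrite -lee_fin -Phi_itv EFinD -Phi_itv.
have -> : `]-oo, (x + h)%R]%classic =
    `]-oo, x]%classic `|` `]x, (x + h)%R]%classic :> set R.
  by rewrite -itv_bndbnd_setU// bnd_simp lerDl.
apply: le_trans (measureU2 _ _ _) _ => //.
apply: leeD => //; rewrite /= /normal_prob.
apply: (@le_trans _ _ (\int[lebesgue_measure]_(t in `]x, (x + h)%R]) 1%:E)%E).
  apply: ge0_le_integral => //.
  - by move=> t _; exact: normal_pdf_ge0.
  - by apply: measurable_funTS; apply/measurable_EFinP; exact: measurable_normal_pdf.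
  - move=> t _; rewrite lee_fin; apply: le_trans (normal_pdf_ub _ _ _) _.
      by rewrite oner_eq0.
    by apply: le_trans peak_le _; lra.
rewrite integral_cst//= lebesgue_measure_itv/= lte_fin mul1e ltrDl.
by case: ltP => // _; rewrite -EFinB addrAC subrr add0r.
Qed.

(** Mills' inequality: for x >= t the density is at most x/(2 t) exp (-x^2/2), by [peak_le] and x/t
    >= 1, and this majorant has the antiderivative [F]. *)
Lemma Phi_tail (t : R) : 0 < t -> Phi (- t) <= expR (- (t ^+ 2 / 2)) / (2 * t).
Proof.
move=> t0; rewrite -lee_fin -normal_prob_itvcy /normal_prob.
pose F (x : R) := - (2 * t)^-1 * expR (- (x ^+ 2 / 2)).
pose f (x : R) := (2 * t)^-1 * (x * expR (- (x ^+ 2 / 2))).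
have f0 (x : R) : t <= x -> 0 <= f x.
  move=> tx; rewrite !mulr_ge0 ?expR_ge0 ?invr_ge0 ?mulr_ge0 ?(ltW t0)//.
  exact: le_trans (ltW t0) tx.
have cf (x : R) : t <= x -> {for x, continuous f}.
  move=> _; apply: cvgMr; apply: cvgM; first exact: cvg_id.
  apply: (cvg_comp _ expR); last exact: continuous_expR.
  by apply: cvgN; apply: cvgMl; exact: sqr_continuous.
have dF (x : R) : t <= x -> is_derive x 1 F (f x).
  move=> tx; apply: is_derive_eq; rewrite /GRing.scale/= /f; field.
  by rewrite gt_eqF.
have F0 : F x @[x --> +oo] --> (0 : R).
  rewrite -[X in _ --> X](mulr0 (- (2 * t)^-1)); apply: cvgMr.
  apply: (cvg_comp (fun x : R => x ^+ 2 / 2) (fun x => expR (- x))); last exact: cvgr_expR.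
  apply: gt0_cvgMly; first by [].
  apply/cvgryPge => A; near=> x.
  have x1 : 1 <= x by near: x; exact: nbhs_pinfty_ge.
  have xA : A <= x by near: x; exact: nbhs_pinfty_ge.
  apply: (le_trans xA); rewrite expr2 ler_peMl//; lra.
apply: (@le_trans _ _ (\int[lebesgue_measure]_(x in `[t, +oo[) (f x)%:E)%E).
  apply: ge0_le_integral => //.
  - by move=> x _; exact: normal_pdf_ge0.
  - by apply: measurable_funTS; apply/measurable_EFinP; exact: measurable_normal_pdf.
  - exact: measurable_int (integrable_tail f0 cf dF F0).
  - move=> x /=; rewrite in_itv/= andbT => tx; rewrite lee_fin normal_pdf01 /f mulrA.
    apply: ler_wpM2r; first exact: expR_ge0.
    apply: (le_trans peak_le); rewrite invfM -mulrA ler_peMr//.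
    by rewrite mulrC ler_pdivlMr ?mul1r.
rewrite (integral_tail f0 cf dF F0) lee_fin /F; by rewrite mulNr sub0r opprK mulrC.
Unshelve. all: by end_near. Qed.

Lemma normal_prob_abs_tail (t : R) : 0 < t ->
  (np [set x : R | (t < `|x|)%R] <= (expR (- (t ^+ 2 / 2)) / t)%:E)%E.
Proof.
move=> t0; have -> : [set x : R | t < `|x|] = `]-oo, (- t)[ `|` `]t, +oo[.
  apply/seteqP; split=> x /=; rewrite !in_itv/= andbT lter_normr.
    by move=> /orP[?|?]; [right|left; lra].
  by move=> [?|?]; apply/orP; [right; lra|left].
apply: le_trans (measureU2 _ _ _) _ => //=.
have h := Phi_tail t0.
apply: (@le_trans _ _ ((Phi (- t))%:E + (Phi (- t))%:E)%E).
  rewrite normal_prob_itvoy leeD2r// -Phi_itv le_measure ?inE//.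
  by apply: subset_itvl; rewrite bnd_simp.
rewrite -EFinD lee_fin; apply: le_trans (lerD h h) _.
rewrite le_eqVlt; apply/orP; left; apply/eqP; field; lra.
Qed.

End Gaussian.

(** * The risk at a fixed sample size *)

Lemma bin_le_expn (n k : nat) : ('C(n, k) <= n ^ k)%N.
Proof.
apply: (@leq_trans (n ^_ k)%N).
  by rewrite -bin_ffact leq_pmulr// fact_gt0.
elim: k => [|k IH]; first by rewrite ffactn0.
by rewrite ffactnSr expnSr leq_mul// leq_subr.
Qed.

(** * Expectations compared with sums of probabilities *)

Section IntegralBounds.
Context {d : measure_display} {T : measurableType d} {R : realType}.
Variable P : probability T R.
Local Open Scope ereal_scope.

(* The integral of a nonnegative function is a supremum over the simple
   functions below it, so monotonicity needs no measurability; the loss of the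
   empirical Bayes rule is never shown to be measurable. *)
Lemma le_integral_nonmeasurable (f g : T -> \bar R) :
  (forall x, 0 <= f x) -> (forall x, f x <= g x) ->
  \int[P]_x f x <= \int[P]_x g x.
Proof.
move=> f0 fg; have g0 x : 0 <= g x by exact: le_trans (fg x).
rewrite !ge0_integralTE//; apply: ereal_sup_le => _ [h hf <-].
by exists h => // x; exact: le_trans (fg x).
Qed.

Lemma integral_sum_indic (I : finType) (E : I -> set T) :
  (forall i, measurable (E i)) ->
  \int[P]_x (\sum_i (\1_(E i) x)%:E) = \sum_i P (E i).
Proof.
move=> mE; rewrite ge0_integral_sum//; last first.
  by move=> i; apply/measurable_EFinP; exact: measurable_indic.
by apply: eq_bigr => i _; rewrite integral_indic// setIT.
Qed.

Lemma expectation_le_sum (I : finType) (E : I -> set T) (f : T -> R) :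
  (forall i, measurable (E i)) -> (forall x, (0 <= f x)%R) ->
  (forall x, (f x <= \sum_i \1_(E i) x)%R) ->
  'E_P[f] <= \sum_i P (E i).
Proof.
move=> mE f0 fE; rewrite expectation.unlock -(integral_sum_indic mE).
by apply: le_integral_nonmeasurable => x; rewrite ?sumEFin lee_fin.
Qed.

Lemma expectation_ge_sum (I : finType) (E : I -> set T) (f : T -> R) :
  (forall i, measurable (E i)) ->
  (forall x, (\sum_i \1_(E i) x <= f x)%R) ->
  \sum_i P (E i) <= 'E_P[f].
Proof.
move=> mE fE; rewrite expectation.unlock -(integral_sum_indic mE).
apply: le_integral_nonmeasurable => x; rewrite sumEFin lee_fin//.
by apply: sumr_ge0 => i _; rewrite indicE.
Qed.

Lemma measure_bigsetU_le (I : Type) (r : seq I) (Q : pred I) (F : I -> set T) :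
  (forall i, measurable (F i)) ->
  P (\big[setU/set0]_(i <- r | Q i) F i) <= \sum_(i <- r | Q i) P (F i).
Proof.
move=> mF; elim: r => [|i r IH]; first by rewrite !big_nil measure0.
rewrite !big_cons; case: ifP => // _.
apply: le_trans (measureU2 _ _ _) _ => //; last exact: leeD2l.
exact: bigsetU_measurable.
Qed.

End IntegralBounds.

(** * Control of [tau_hat] and of the expected Hamming loss *)

Section FixedSampleSize.
Context {R : realType} {d : measure_display} {T : measurableType d}.
Variables (P : probability T R) (n : nat) (eps : 'I_n -> {RV P >-> R}).
Hypothesis eps_indep : mutually_independent eps.
Hypothesis eps_normal : forall i, standard_normal (eps i).

Local Notation np := (@normal_prob R 0 1).

Let eps_np (i : 'I_n) (B : set R) : measurable B ->
  P (eps i @^-1` B) = np B.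
Proof. by move=> mB; rewrite -(eps_normal i mB). Qed.

Let meps (i : 'I_n) (B : set R) : measurable B -> measurable (eps i @^-1` B).
Proof. by move=> mB; rewrite -[_ @^-1` _]setTI; exact: (measurable_funP (eps i)). Qed.

Lemma measurable_abs_gt (t : R) : measurable [set x : R | t < `|x|].
Proof.
rewrite (_ : [set x | _] = (fun x : R => `|x|) @^-1` `]t, +oo[); last first.
  by apply/seteqP; split => x /=; rewrite in_itv/= andbT.
by rewrite -[_ @^-1` _]setTI; exact: normr_measurable.
Qed.

(** Stated for the errors rather than the observations, so the exceptional event is the same for
    every theta. *)
Definition many_exceed (t : R) (k : nat) : set T :=
  [set w | (k < #|[set j | (t < `|eps j w|)%R]%SET|)%N].

Let exceed_set (t : R) (J : {set 'I_n}) : set T :=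
  \bigcap_(j in [set` J]) (eps j @^-1` [set x | t < `|x|]).

Let measurable_exceed_set (t : R) (J : {set 'I_n}) : measurable (exceed_set t J).
Proof.
apply: fin_bigcap_measurable => // j _; apply: meps; exact: measurable_abs_gt.
Qed.

(** More than k errors exceed t exactly when all errors indexed by some set of size k + 1 do. The
    finite union yields both measurability and the union bound. *)
Let many_exceedE (t : R) (k : nat) :
  many_exceed t k =
  \big[setU/set0]_(J : {set 'I_n} | #|J| == k.+1) exceed_set t J.
Proof.
rewrite -bigcup_seq_cond; apply/seteqP; split=> w.
  rewrite /many_exceed /=; set A := [set j | _]%SET => kA.
  have : (0 < #|[set J : {set 'I_n} | (J \subset A) && (#|J| == k.+1)]%SET|)%N.
    by rewrite cards_draws bin_gt0.
  move=> /card_gt0P[J]; rewrite inE => /andP[/fintype.subsetP JA Jk].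
  exists J; first by rewrite /= mem_index_enum.
  by move=> j /= /JA; rewrite inE.
move=> [J /= /andP[_ /eqP Jk] JG]; rewrite /many_exceed /= -Jk.
apply: subset_leq_card; apply/fintype.subsetP => j jJ; rewrite inE.
exact: JG.
Qed.

Lemma measurable_many_exceed (t : R) (k : nat) : measurable (many_exceed t k).
Proof. by rewrite many_exceedE; exact: bigsetU_measurable. Qed.

(** Union bound over the 'C(n, k+1) <= n^(k+1) index sets; by independence each contributes the
    (k+1)-st power of the one-coordinate probability. *)
Lemma many_exceed_prob (t p : R) (k : nat) :
  (np [set x : R | (t < `|x|)%R] <= p%:E)%E ->
  (P (many_exceed t k) <= ((n%:R * p) ^+ k.+1)%:E)%E.
Proof.
move=> tp; set B := [set x : R | t < `|x|].
have mB : measurable B := measurable_abs_gt t.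
have p0 : 0 <= p by rewrite -lee_fin; apply: le_trans tp; exact: measure_ge0.
have npr : np B = (fine (np B))%:E by rewrite fineK// fin_num_measure.
have r0 : 0 <= fine (np B) by rewrite fine_ge0// measure_ge0.
have rp : fine (np B) <= p by rewrite -lee_fin -npr.
have PJ J : P (exceed_set t J) = ((fine (np B)) ^+ #|J|)%:E.
  rewrite /exceed_set (eps_indep J (B := fun=> B))//.
  rewrite (eq_bigr (fun=> (fine (np B))%:E)); last first.
    by move=> j _; rewrite eps_np.
  by rewrite prodEFin prodr_const.
rewrite many_exceedE; apply: le_trans (measure_bigsetU_le _ _ _ _) _ => //.
rewrite (eq_bigr (fun=> (fine (np B) ^+ k.+1)%:E)); last first.
  by move=> J /eqP Jk; rewrite PJ Jk.
rewrite sumEFin lee_fin sumr_const.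
have -> : #|[pred J : {set 'I_n} | #|J| == k.+1]| = 'C(n, k.+1).
  by rewrite -[n in RHS]card_ord -card_draws; apply: eq_card => J; rewrite !inE.
rewrite -[leLHS]mulr_natl exprMn ler_pM ?exprn_ge0//.
  by rewrite -natrX ler_nat bin_le_expn.
by rewrite lerXn2r ?nnegrE.
Qed.

Variables (q : nat) (L : R -> R) (c1 c2 tlo tup v : R).
Hypotheses (n_gt0 : (0 < n)%N) (q_gt0 : (0 < q)%N) (c2_ge1 : 1 <= c2).

Let thr : R := Num.sqrt (c1 * ln n%:R).
Let G := many_exceed thr q.

Lemma tau_hat_ge (X : 'rV[R]_n) : 1 / n%:R <= tau_hat c1 c2 X.
Proof. by rewrite /tau_hat le_max lexx. Qed.

(** Here m >= 1 takes care of the floor 1/n, and c2 >= 1 of the normalized count. *)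
Let tau_hat_le (X : 'rV[R]_n) (m : nat) : (0 < m)%N ->
  (\sum_(j < n) (Num.sqrt (c1 * ln n%:R) < `|X 0 j|)%R <= m)%N ->
  tau_hat c1 c2 X <= m%:R / n%:R.
Proof.
move=> m0 Xm; have n0 : (0 : R) < n%:R by rewrite ltr0n.
have c20 : 0 < c2 := lt_le_trans ltr01 c2_ge1.
rewrite /tau_hat ge_max; apply/andP; split.
  by rewrite ler_pM2r ?invr_gt0// ler1n.
rewrite mulrC; apply: ler_pM; rewrite ?sumr_ge0//.
- by rewrite divr_ge0// mulr_ge0// ltW.
- by rewrite -natr_sum ler_nat.
- by rewrite div1r lef_pV2 ?posrE ?mulr_gt0// ler_peMl// ltW.
Qed.

Lemma tau_hat_le1 (X : 'rV[R]_n) : tau_hat c1 c2 X <= 1.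
Proof.
rewrite -[leRHS](@divff _ n%:R) ?pnatr_eq0 -?lt0n//; apply: tau_hat_le => //.
apply: (@leq_trans (\sum_(j < n) 1)%N); last by rewrite sum1_card card_ord.
by apply: leq_sum => j _; case: (_ < _).
Qed.

(** Each of the q signals counts at most once; a null coordinate counts only if its error exceeds
    the cutoff, which happens at most q times outside [G]. *)
Let tau_hat_le_sparse (theta : 'rV[R]_n) (w : T) :
  #|[set i | theta 0 i != 0]%SET| = q -> ~ G w ->
  tau_hat c1 c2 (observation theta eps w) <= (2 * q)%:R / n%:R.
Proof.
move=> thq /negP; rewrite -leqNgt => Gw; apply: tau_hat_le.
  by rewrite muln_gt0.
rewrite mul2n -addnn -{1}thq; apply: leq_trans (leq_add (leqnn _) Gw).
have cardE (Q : pred 'I_n) : #|[set j | Q j]%SET| = (\sum_(j < n) Q j)%N.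
  by rewrite -sum1dep_card big_mkcond; apply: eq_bigr => j _; case: (Q j).
rewrite !cardE -big_split/=; apply: leq_sum => j _.
rewrite /observation mxE; case: eqVneq => [->|_]; last by case: (_ < _).
by rewrite add0r.
Qed.

(** The posterior enters the loss bounds only through two thresholds: [reject] covers all values
    that [tau_hat] can take, [accept] those that it takes outside [G]. *)
Hypothesis reject : forall tau x : R, 1 / n%:R <= tau <= 1 -> tlo <= `|x| ->
  1 / 2 < posterior_shrinkage (1 / 2) L tau x.
Hypothesis accept : forall tau x : R, 1 / n%:R <= tau <= (2 * q)%:R / n%:R ->
  `|x| <= tup -> posterior_shrinkage (1 / 2) L tau x <= 1 / 2.

Let loss (theta : 'rV[R]_n) (w : T) : R :=
  (hamming_loss theta (eb_rule (1 / 2) L c1 c2 (observation theta eps w)))%:R.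

Let lossE (theta : 'rV[R]_n) (w : T) : loss theta w = \sum_(i < n)
  (((theta 0%R i == 0%R) &&
     eb_rule (1 / 2) L c1 c2 (observation theta eps w) i) +
   ((theta 0%R i != 0%R) &&
     ~~ eb_rule (1 / 2) L c1 c2 (observation theta eps w) i))%N%:R.
Proof. by rewrite /loss /hamming_loss natr_sum. Qed.

Let leqb (a b : bool) : (a -> b) -> (a <= b)%N.
Proof. by case: a; case: b => // /(_ isT). Qed.

Let measurable_shift (m : R) : measurable_fun setT (fun x : R => `|m + x|).
Proof. by apply: measurableT_comp => //; exact: measurable_funD. Qed.

Let measurable_shift_lt (m y : R) : measurable [set x : R | `|m + x| < y].
Proof.
rewrite (_ : [set x | _] = (fun x : R => `|m + x|) @^-1` `]-oo, y[).
  by rewrite -[_ @^-1` _]setTI; exact: measurable_shift.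
by apply/seteqP; split => x /=; rewrite ?in_itv.
Qed.

Let measurable_shift_le (m y : R) : measurable [set x : R | `|m + x| <= y].
Proof.
rewrite (_ : [set x | _] = (fun x : R => `|m + x|) @^-1` `]-oo, y]).
  by rewrite -[_ @^-1` _]setTI; exact: measurable_shift.
by apply/seteqP; split => x /=; rewrite ?in_itv.
Qed.

(** Of the two inequalities in |m + x| < y only one is kept, chosen by the sign of m. *)
Let np_shift_lt (m y : R) :
  (np [set x : R | (`|m + x| < y)%R] <= (Phi (y - `|m|))%:E)%E.
Proof.
have [m0|m0] := leP 0 m.
  rewrite -Phi_itv ger0_norm//; apply: le_measure; rewrite ?inE//.
    exact: measurable_shift_lt.
  by move=> x /=; rewrite in_itv/= ltr_norml => /andP[_]; lra.
rewrite ltr0_norm// -[y - - m]opprK -normal_prob_itvcy.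
apply: le_measure; rewrite ?inE//; first exact: measurable_shift_lt.
by move=> x /=; rewrite in_itv/= andbT ltr_norml => /andP[+ _]; lra.
Qed.

(** If x <= y - m but |m + x| > y, then m + x < -y, so x < -y because m >= 0. The loss is thus at
    most the mass of |x| > y. *)
Let np_shift_le (m y : R) : 0 <= m ->
  (np [set x : R | (y < `|x|)%R] <= v%:E)%E ->
  ((Phi (y - m) - v)%:E <= np [set x : R | (`|m + x| <= y)%R])%E.
Proof.
move=> m0 yv; rewrite EFinB leeBlDr// -Phi_itv.
apply: (@le_trans _ _ (np ([set x : R | `|m + x| <= y] `|` [set x : R | y < `|x|]))).
  apply: le_measure; rewrite ?inE//.
    by apply: measurableU; [exact: measurable_shift_le|exact: measurable_abs_gt].
  move=> x /=; rewrite in_itv/= => xy.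
  rewrite ler_norml lter_normr; case: (leP (- y) (m + x)) => h; [left|right]; lra.
apply: le_trans (measureU2 _ _ _) _; last exact: leeD2l.
  exact: measurable_shift_le.
exact: measurable_abs_gt.
Qed.

Variable g : R.
Hypothesis np_tup : (np [set x : R | (tup < `|x|)%R] <= v%:E)%E.
Hypothesis P_G : (P (many_exceed (Num.sqrt (c1 * ln n%:R)) q) <= g%:E)%E.

Lemma expected_loss_le (theta : 'rV[R]_n) (m : R) :
  #|[set i | theta 0 i != 0]%SET| = q ->
  (forall i, theta 0 i != 0 -> m <= `|theta 0 i|) ->
  ('E_P[loss theta] <= (q%:R * Phi (tlo - m) + n%:R * (v + g))%:E)%E.
Proof.
move=> thq thm.
(* Events containing the errors of the test: a null is rejected only if |eps_i| > [tup] or on [G], a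
   signal is missed only if |X_i| < [tlo]. The probability of [G] is charged to each null, whence
   the term n g. *)
pose E (i : 'I_n) : set T := if theta 0 i == 0
  then (eps i @^-1` [set x | tup < `|x|]) `|` G
  else eps i @^-1` [set x | `|theta 0 i + x| < tlo].
have mG : measurable G by exact: measurable_many_exceed.
have mE i : measurable (E i).
  rewrite /E; case: ifP => _; last by apply: meps; exact: measurable_shift_lt.
  by apply: measurableU => //; apply: meps; exact: measurable_abs_gt.
have v0 : 0 <= v by rewrite -lee_fin; apply: le_trans np_tup; exact: measure_ge0.
have g0 : 0 <= g by rewrite -lee_fin; apply: le_trans P_G; exact: measure_ge0.
apply: (le_trans (expectation_le_sum P (f := loss theta) mE _ _)).
- by move=> w; rewrite /loss.
- move=> w; rewrite lossE; apply: ler_sum => i _; rewrite indicE.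
  rewrite /eb_rule; set tau := tau_hat _ _ _.
  have tau_n : 1 / n%:R <= tau by exact: tau_hat_ge.
  have tau_1 : tau <= 1 by exact: tau_hat_le1.
  rewrite mxE /E; case: eqVneq => [->|thi] /=.
    rewrite addn0 add0r ler_nat; apply: leqb => rej.
    rewrite inE /=; apply: contrapT => /not_orP[/negP]; rewrite -leNgt => le_tup nG.
    move: rej; apply/negP; rewrite -leNgt; apply: accept => //.
    by rewrite tau_n/=; exact: tau_hat_le_sparse.
  rewrite add0n ler_nat; apply: leqb => nrej.
  rewrite inE /= ltNge; apply: contra nrej => ?.
  by apply: reject => //; rewrite tau_n.
rewrite (bigID (fun i => theta 0 i != 0))/=.
apply: (@le_trans _ _ (\sum_(i < n | theta 0%R i != 0%R) (Phi (tlo - m))%:E +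
                       \sum_(i < n | ~~ (theta 0%R i != 0%R)) (v + g)%:E)%E).
  apply: leeD; apply: lee_sum => i.
    move=> thi; rewrite /E (negbTE thi) eps_np; last exact: measurable_shift_lt.
    apply: le_trans (np_shift_lt _ _) _.
    by rewrite lee_fin; apply: Phi_mono; rewrite lerB// thm.
  rewrite negbK => thi; rewrite /E thi.
  apply: le_trans (measureU2 _ _ _) _ => //.
    by apply: meps; exact: measurable_abs_gt.
  rewrite EFinD; apply: leeD; last exact: P_G.
  by apply: (le_trans _ np_tup); rewrite -(eps_np i (measurable_abs_gt tup)).
rewrite !sumEFin -EFinD lee_fin !sumr_const; apply: lerD.
  rewrite -[leLHS]mulr_natl; apply: ler_wpM2r; first exact: Phi_ge0.
  by rewrite ler_nat -thq -cardsE.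
rewrite -[leLHS]mulr_natl; apply: ler_wpM2r; first exact: addr_ge0.
by rewrite ler_nat -[leqRHS]card_ord max_card.
Qed.

Lemma expected_loss_ge (theta : 'rV[R]_n) (m : R) : 0 < m ->
  #|[set i | theta 0 i != 0]%SET| = q ->
  (forall i, theta 0 i != 0 -> theta 0 i = m) ->
  ((q%:R * (Phi (tup - m) - v - g))%:E <= 'E_P[loss theta])%E.
Proof.
move=> m0 thq thm.
(* False positives are dropped; a signal is certainly missed when |X_i| <= [tup] outside [G]. *)
pose E (i : 'I_n) : set T := if theta 0 i == 0 then set0
  else (eps i @^-1` [set x | `|m + x| <= tup]) `\` G.
have mG : measurable G by exact: measurable_many_exceed.
have mE i : measurable (E i).
  rewrite /E; case: ifP => _ //; apply: measurableD => //.
  by apply: meps; exact: measurable_shift_le.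
apply: (le_trans _ (expectation_ge_sum P (f := loss theta) mE _)); last first.
  move=> w; rewrite lossE; apply: ler_sum => i _; rewrite indicE.
  rewrite /eb_rule; set tau := tau_hat _ _ _.
  have tau_n : 1 / n%:R <= tau by exact: tau_hat_ge.
  rewrite mxE /E; case: eqVneq => [->|thi] /=; first by rewrite in_set0.
  rewrite add0n ler_nat; apply: leqb; rewrite inE => -[/= xm nG].
  rewrite -leNgt thm//; apply: accept => //.
  by rewrite tau_n/=; exact: tau_hat_le_sparse.
rewrite (bigID (fun i => theta 0 i != 0))/=.
apply: (@le_trans _ _ (\sum_(i < n | theta 0%R i != 0%R) (Phi (tup - m) - v - g)%:E)%E).
  rewrite sumEFin lee_fin sumr_const -[leRHS]mulr_natl.
  by rewrite -[q in q%:R * _]thq cardsE.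
apply: (@le_trans _ _ (\sum_(i < n | theta 0%R i != 0%R) P (E i))%E); last first.
  by apply: leeDl; apply: sume_ge0 => i _; exact: measure_ge0.
apply: lee_sum => i thi; rewrite /E (negbTE thi).
have mA : measurable (eps i @^-1` [set x | `|m + x| <= tup]).
  by apply: meps; exact: measurable_shift_le.
rewrite EFinB leeBlDr//.
apply: (@le_trans _ _ (P (eps i @^-1` [set x | `|m + x| <= tup]))).
  rewrite eps_np; last exact: measurable_shift_le.
  by apply: np_shift_le => //; exact: ltW.
apply: (@le_trans _ _ (P ((eps i @^-1` [set x : R | (`|m + x| <= tup)%R]) `\` G) + P G)%E);
  last exact: leeD2l.
apply: le_trans (measureU2 _ _ _) => //; last exact: measurableD.
apply: le_measure; rewrite ?inE//.
  by apply: measurableU => //; exact: measurableD.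
by move=> w Aw; have [?|?] := pselect (G w); [right|left].
Qed.

End FixedSampleSize.

(** * Asymptotics *)

Section Asymptotics.
Context {R : realType}.

(** The risk is an extended real; real bounds on both sides also supply the eventual finiteness that
    passing to real limits requires. *)
Lemma cvge0_squeeze (x : (\bar R)^nat) :
  (forall e : R, 0 < e -> \forall n \near \oo, ((- e)%:E <= x n <= e%:E)%E) ->
  x n @[n --> \oo] --> 0%E.
Proof.
move=> h; apply/fine_cvgP; split.
  near=> n; have /andP[l u] : ((- 1)%:E <= x n <= 1%:E)%E by near: n; exact: h.
  by rewrite fin_numElt (lt_le_trans (ltNyr _) l) (le_lt_trans u (ltry _)).
apply/cvgrPdist_le => e e0; near=> n.
have /andP[l u] : ((- e)%:E <= x n <= e%:E)%E by near: n; exact: h.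
have xf : x n \is a fin_num.
  by rewrite fin_numElt (lt_le_trans (ltNyr _) l) (le_lt_trans u (ltry _)).
move: l u; rewrite sub0r normrN /= -(fineK xf) !lee_fin => l u.
by rewrite ler_norml l u.
Unshelve. all: by end_near. Qed.

Lemma cvgn_ln (A : R) : \forall n \near \oo, A <= ln n%:R :> R.
Proof.
near=> n; rewrite -[A]expRK ler_ln ?posrE ?expR_gt0//.
  near: n; exact: nbhs_infty_ger.
rewrite ltr0n; near: n; exact: nbhs_infty_gt.
Unshelve. all: by end_near. Qed.

(* u = x^2/2 - ln n is at least eta * sqrt(2 ln n), so x^2 is at most quadratic
   in u while n^-1 * expR (x^2/2) = expR u. *)
Lemma signal_threshold (C eta : R) : 0 < C -> 0 < eta ->
  \forall n \near \oo, forall tau x : R, 1 / n%:R <= tau ->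
    Num.sqrt (2 * ln n%:R) + eta <= `|x| ->
    C <= x ^+ 2 /\ C * x ^+ 2 <= tau * expR (x ^+ 2 / 2).
Proof.
move=> C0 eta0.
(* With l = ln n, this choice gives C (u + l) <= B u^2 / 12, hence C x^2 = 2 C (u + l) <= u^3 / 6 <=
   exp u once u >= B. *)
pose B := 12 * C * (1 + (2 * eta ^+ 2)^-1).
have e2 : 0 < eta ^+ 2 by rewrite exprn_gt0.
have B0 : 0 < B by rewrite !mulr_gt0// addr_gt0// invr_gt0 mulr_gt0.
near=> n => tau x ntau tx.
have n0 : (0 : R) < n%:R by rewrite ltr0n; near: n; exact: nbhs_infty_gt.
have lC : C <= ln n%:R by near: n; exact: cvgn_ln.
have lB : ((B + 1) / eta) ^+ 2 <= ln n%:R by near: n; exact: cvgn_ln.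
set l : R := ln n%:R in tx lC lB.
have l0 : 0 < l by exact: lt_le_trans lC.
set r := Num.sqrt (2 * l) in tx.
have r0 : 0 <= r by exact: sqrtr_ge0.
have r2 : r ^+ 2 = 2 * l by rewrite sqr_sqrtr// mulr_ge0// ltW.
have Be0 : 0 <= (B + 1) / eta by rewrite divr_ge0 ?(ltW eta0)//; lra.
have rB : B + 1 <= eta * r.
  rewrite -ler_pdivrMl// mulrC -(@ler_pXn2r _ 2%N) ?nnegrE//.
  by rewrite r2; lra.
have x2 : (r + eta) ^+ 2 <= x ^+ 2.
  rewrite -[x ^+ 2]real_normK ?num_real//.
  by rewrite ler_pXn2r ?nnegrE// addr_ge0// ltW.
rewrite sqrrD r2 in x2.
set u := x ^+ 2 / 2 - l.
have ur : eta * r <= u.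
  rewrite /u; have : r * eta *+ 2 = 2 * (eta * r) by rewrite -mulr_natl; ring.
  lra.
have u1 : 1 <= u by lra.
have uB : B <= u by lra.
have lu : l <= u ^+ 2 * (2 * eta ^+ 2)^-1.
  rewrite ler_pdivlMr ?mulr_gt0//.
  have -> : l * (2 * eta ^+ 2) = (eta * r) ^+ 2 by rewrite exprMn r2; ring.
  by rewrite ler_pXn2r ?nnegrE//; [rewrite mulr_ge0// ltW|lra].
split; first by have := ltW e2; rewrite /u in u1; lra.
have -> : x ^+ 2 = 2 * (u + l) by rewrite /u; field.
have -> : 2 * (u + l) / 2 = u + l by field.
apply: (@le_trans _ _ (expR u)); last first.
  have -> : expR (u + l) = expR u * n%:R by rewrite expRD /l lnK ?posrE.
  rewrite mulrCA ler_peMr ?expR_ge0//.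
  by rewrite -ler_pdivrMr.
have e3 : u ^+ 3 / 6 <= expR u.
  have := @expR_ge1Dxn R u 2 _; have -> : 3`!%:R = 6 :> R by [].
  by move=> h; have := h (le_trans ler01 u1); lra.
apply: le_trans e3.
have uu : u <= u ^+ 2 by rewrite expr2 ler_peMl//; lra.
have h : B * u ^+ 2 <= u * u ^+ 2 by rewrite ler_wpM2r ?sqr_ge0.
have : C * (u + l) <= C * (u ^+ 2 + u ^+ 2 * (2 * eta ^+ 2)^-1).
  by rewrite ler_pM2l//; lra.
have -> : C * (u ^+ 2 + u ^+ 2 * (2 * eta ^+ 2)^-1) = B * u ^+ 2 / 12.
  by rewrite /B; field; rewrite gt_eqF.
move: h; rewrite -exprS; lra.
Unshelve. all: by end_near. Qed.

(** * Growth of q compared with n and ln n *)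

Variables (q : nat -> nat) (delta : R).
Hypothesis q_gt0 : forall n, (0 < q n)%N.
Hypothesis q_sparse : (q n)%:R / n%:R @[n --> \oo] --> (0 : R).
Hypothesis delta_gt1 : 1 < delta.
Hypothesis q_rate : asymp (fun n => (q n)%:R) (fun n => ln n%:R `^ delta : R).

Lemma q_le_n (A : R) : 0 < A -> \forall n \near \oo, A * (q n)%:R <= n%:R.
Proof.
move=> A0; have /cvgrPdist_le/(_ A^-1) := q_sparse.
rewrite invr_gt0 => /(_ A0) h; near=> n.
have n0 : (0 : R) < n%:R by rewrite ltr0n; near: n; exact: nbhs_infty_gt.
have : `|0 - (q n)%:R / n%:R| <= A^-1 by near: n.
rewrite sub0r normrN ger0_norm ?divr_ge0//.
by rewrite ler_pdivrMr// mulrC ler_pdivlMr// mulrC.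
Unshelve. all: by end_near. Qed.

(** Up to a constant, q is at least (ln n)^delta = ln n * (ln n)^(delta - 1), and the last factor
    diverges as delta > 1. *)
Lemma ln_le_q (A : R) : 0 < A -> \forall n \near \oo, A * ln n%:R <= (q n)%:R.
Proof.
move=> A0; have [c [c' [c0 h]]] := q_rate.
have d0 : 0 < delta - 1 by rewrite subr_gt0.
near=> n.
have l0 : 1 <= ln n%:R :> R by near: n; exact: cvgn_ln.
have lp : 0 < ln n%:R `^ delta :> R by rewrite powR_gt0//; lra.
have : c <= (q n)%:R / ln n%:R `^ delta <= c' by near: n.
rewrite ler_pdivlMr// => /andP[+ _]; apply: le_trans.
have -> : delta = 1 + (delta - 1) by ring.
have lz : 0 < ln n%:R :> R by lra.
rewrite powRD; last by rewrite (gt_eqF lz) implybT.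
rewrite powRr1; last lra.
rewrite mulrCA mulrC ler_pM2l// -ler_pdivrMl//.
have -> : c^-1 * A = ((c^-1 * A) `^ (delta - 1)^-1) `^ (delta - 1).
  by rewrite -powRrM mulVf ?gt_eqF// powRr1// mulr_ge0 ?invr_ge0 ?ltW.
apply: ge0_ler_powR; [exact: ltW|by rewrite nnegrE powR_ge0|
  by rewrite nnegrE ltW|by near: n; exact: cvgn_ln].
Unshelve. all: by end_near. Qed.

(** ln q is at most ln c' + delta ln (ln n). With r = (ln n)^(1/4) one has ln (ln n) = 4 ln r <= 4
    r, while the target is e r^2, so a large r suffices. *)
Lemma ln_q_le (e : R) : 0 < e ->
  \forall n \near \oo, ln (q n)%:R <= e * Num.sqrt (ln n%:R).
Proof.
move=> e0; have [c [c' [c0 h]]] := q_rate.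
have d0 : 0 < delta := lt_trans ltr01 delta_gt1.
pose B := (`|ln c'| + 4 * delta) / e + 1.
have B1 : 1 <= B by rewrite lerDr divr_ge0 ?(ltW e0)// addr_ge0// mulr_ge0// ltW.
near=> n.
have l0 : (B ^+ 2) ^+ 2 <= ln n%:R by near: n; exact: cvgn_ln.
have B0 : 0 < B by exact: lt_le_trans B1.
have lz : 0 < ln n%:R :> R by apply: lt_le_trans l0; rewrite !exprn_gt0.
have lp : 0 < ln n%:R `^ delta :> R by rewrite powR_gt0.
have : c <= (q n)%:R / ln n%:R `^ delta <= c' by near: n.
move=> /andP[cq qc].
have c'0 : 0 < c' by exact: lt_le_trans c0 (le_trans cq qc).
rewrite ler_pdivrMr// in qc.
have q0 : (0 : R) < (q n)%:R by rewrite ltr0n.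
move: l0 lz lp qc; set l : R := ln n%:R => l0 lz lp qc.
set s := Num.sqrt l; set r := Num.sqrt s.
have s0 : 0 < s by rewrite sqrtr_gt0.
have s2 : s ^+ 2 = l by rewrite sqr_sqrtr// ltW.
have r2 : r ^+ 2 = s by rewrite sqr_sqrtr// ltW.
have r0 : 0 < r by rewrite sqrtr_gt0.
have rB : B <= r.
  rewrite -(@ler_pXn2r _ 2%N) ?nnegrE ?(ltW r0) ?(ltW B0)//.
  by rewrite -(@ler_pXn2r _ 2%N) ?nnegrE ?sqr_ge0// r2 s2.
have lnl : ln l <= 4 * r.
  rewrite -s2 -r2 !lnXn ?exprn_gt0//.
  have := ln_sublinear r0; lra.
have : ln (q n)%:R <= ln c' + delta * ln l.
  by rewrite -ln_powR -lnM ?posrE// ler_ln ?posrE// mulr_gt0.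
move/le_trans; apply.
have h1 : ln c' <= `|ln c'| by exact: ler_norm.
have h2 : delta * ln l <= delta * (4 * r) by rewrite ler_pM2l.
have r1 : 1 <= r by lra.
have h3 : `|ln c'| <= `|ln c'| * r by rewrite ler_peMr.
have h4 : (`|ln c'| + 4 * delta) * r <= e * r * r.
  rewrite ler_pM2r// -ler_pdivrMl// mulrC.
  by apply: le_trans rB; rewrite /B; lra.
rewrite -r2 expr2; lra.
Unshelve. all: by end_near. Qed.

Lemma ln_n_q (A : R) : \forall n \near \oo, A <= ln (n%:R / (q n)%:R).
Proof.
near=> n.
have n0 : (0 : R) < n%:R by rewrite ltr0n; near: n; exact: nbhs_infty_gt.
have q0 : (0 : R) < (q n)%:R by rewrite ltr0n.
rewrite -[A]expRK ler_ln ?posrE ?expR_gt0 ?divr_gt0//.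
rewrite ler_pdivlMr//; near: n; apply: q_le_n; exact: expR_gt0.
Unshelve. all: by end_near. Qed.

(** Let l = ln n, k = ln q and m^2 = 2 (l - k). Squaring, it is enough that k <= eta m, which
    follows from k <= eta sqrt l and sqrt l <= m. *)
Lemma sqrt_ln_n (eta : R) : 0 < eta -> \forall n \near \oo,
  Num.sqrt (2 * ln n%:R) <= Num.sqrt (2 * ln (n%:R / (q n)%:R)) + eta.
Proof.
move=> eta0.
(* The bound 1/2 gives k <= sqrt l / 2 <= l / 2, hence m^2 >= l; the bound eta gives k <= eta sqrt
   l. *)
have e20 : 0 < Num.min eta 2^-1 by rewrite lt_min eta0/= invr_gt0.
near=> n.
have n0 : (0 : R) < n%:R by rewrite ltr0n; near: n; exact: nbhs_infty_gt.
have q0 : (0 : R) < (q n)%:R by rewrite ltr0n.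
have q1 : (1 : R) <= (q n)%:R by rewrite ler1n.
have l1 : 1 <= ln n%:R :> R by near: n; exact: cvgn_ln.
have lq : ln (q n)%:R <= Num.min eta 2^-1 * Num.sqrt (ln n%:R).
  by near: n; apply: ln_q_le.
rewrite ln_div ?posrE//.
have lq0 := ln_ge0 q1.
move: l1 lq lq0; set l : R := ln n%:R; set k := ln _ => l1 lq k0.
set s := Num.sqrt l in lq.
have s2 : s ^+ 2 = l by rewrite sqr_sqrtr//; lra.
have s0 : 0 <= s by exact: sqrtr_ge0.
have s1 : 1 <= s by rewrite -(@ler_pXn2r _ 2%N) ?nnegrE// s2 expr1n.
have k1 : k <= eta * s.
  by apply: le_trans lq _; rewrite ler_wpM2r// ge_min lexx.
have k2 : k <= 2^-1 * s.
  by apply: le_trans lq _; rewrite ler_wpM2r// ge_min lexx orbT.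
have ss : s <= s ^+ 2 by rewrite expr2 ler_peMl.
set m := Num.sqrt (2 * (l - k)).
have m2 : m ^+ 2 = 2 * (l - k) by rewrite sqr_sqrtr//; lra.
have m0 : 0 <= m by exact: sqrtr_ge0.
have sm : s <= m by rewrite -(@ler_pXn2r _ 2%N) ?nnegrE// m2 s2; lra.
have me : 0 <= m + eta by lra.
rewrite -[leRHS]ger0_norm// -sqrtr_sqr ler_sqrt ?sqr_ge0//.
have em : eta * s <= eta * m by rewrite ler_pM2l.
rewrite sqrrD m2 -[m * eta *+ 2]mulr_natl; have := sqr_ge0 eta; lra.
Unshelve. all: by end_near. Qed.

End Asymptotics.

(** * Convergence of the normalized risk *)

Lemma card_ord_lt (n q : nat) : (q <= n)%N -> #|[set i : 'I_n | (i < q)%N]%SET| = q.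
Proof.
move=> qn; rewrite -sum1dep_card -(big_ord_widen n (fun=> 1%N) qn).
by rewrite sum1_card card_ord.
Qed.

Definition sparse_vector (R : realType) (n q : nat) (m : R) : 'rV[R]_n :=
  \row_i (if (i < q)%N then m else 0).

Section SparseVector.
Context {R : realType}.
Variables (n q : nat) (m : R).
Hypotheses (qn : (q <= n)%N) (m0 : m != 0).

Lemma sparse_vector_neq0 (i : 'I_n) :
  (sparse_vector n q m 0 i != 0) = (i < q)%N.
Proof. by rewrite mxE; case: ifP => _; rewrite ?m0 ?eqxx. Qed.

Lemma card_sparse_vector : #|[set i | sparse_vector n q m 0 i != 0]%SET| = q.
Proof.
rewrite -[RHS](card_ord_lt qn); apply: eq_card => i.
by rewrite !inE sparse_vector_neq0.
Qed.

Lemma sparse_vectorE (i : 'I_n) :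
  sparse_vector n q m 0 i != 0 -> sparse_vector n q m 0 i = m.
Proof. by rewrite sparse_vector_neq0 mxE => ->. Qed.

End SparseVector.

(** * Choice of thresholds and matching risk bounds *)

Section MainResult.
Context {R : realType}.
Variables (q : nat -> nat) (delta : R).
Hypothesis q_gt0 : forall n, (0 < q n)%N.
Hypothesis q_sparse : (q n)%:R / n%:R @[n --> \oo] --> (0 : R).
Hypothesis delta_gt1 : 1 < delta.
Hypothesis q_rate : asymp (fun n => (q n)%:R) (fun n => ln n%:R `^ delta : R).
Variables (K : R) (L : R -> R).
Hypothesis prior : one_group_prior K (1 / 2) L.
Hypothesis A1 : exists c0 t0 : R,
  [/\ 0 < c0, 0 < t0 & forall t, t0 <= t -> c0 <= L t].
Hypothesis A2 : exists M : R, 0 < M /\ forall t, 0 < t -> L t <= M.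
Variables (c1 c2 : R).
Hypotheses (c1_ge2 : 2 <= c1) (c2_ge1 : 1 <= c2).

Local Notation np := (@normal_prob R 0 1).
Local Notation mn := (fun n => Num.sqrt (2 * ln (n%:R / (q n)%:R)) : R).

(** The data required by the loss bounds at sample size n, with error budget eta. [thr_exceed]
    speaks of the normal law only, so the thresholds do not depend on the probability spaces. *)
Record thresholds (eta : R) (n : nat) (tlo tup v g : R) : Prop := {
  thr_reject : forall tau x : R, 1 / n%:R <= tau <= 1 -> tlo <= `|x| ->
    1 / 2 < posterior_shrinkage (1 / 2) L tau x ;
  thr_accept : forall tau x : R, 1 / n%:R <= tau <= (2 * q n)%:R / n%:R ->
    `|x| <= tup -> posterior_shrinkage (1 / 2) L tau x <= 1 / 2 ;
  thr_tail : (np [set x : R | (tup < `|x|)%R] <= v%:E)%E ;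
  thr_exceed : exists2 p : R,
    (np [set x : R | (Num.sqrt (c1 * ln n%:R) < `|x|)%R] <= p%:E)%E &
    (n%:R * p) ^+ (q n).+1 <= g ;
  thr_lo : tlo <= mn n + eta ;
  thr_up : mn n - eta <= tup ;
  thr_small : n%:R * (v + g) <= eta * (q n)%:R
}.

Lemma exists_thresholds (eta : R) : 0 < eta ->
  \forall n \near \oo, exists tlo tup v g : R, thresholds eta n tlo tup v g.
Proof.
move=> eta0; have [c0 [t0 [c00 t00 Lc0]]] := A1; have [M [M0 LM]] := A2.
have [C0 C00 upper] := posterior_shrinkage_le prior c00 t00 Lc0 M0 LM.
have [C C'0 lower] := posterior_shrinkage_gt_half prior c00 t00 Lc0 M0 LM.
have e20 : 0 < eta / 2 by rewrite divr_gt0.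
(* With tau <= 2q/n and exp ([tup]^2/2) = n/(c q), the bound C0 tau exp (x^2/2) becomes exactly
   1/2. *)
pose c := 4 * C0; have cpos : 0 < c by rewrite mulr_gt0.
(* A lower bound for [tup]: the first summand brings [tup] within eta of the beta-min level, the
   second makes c / [tup] <= eta / 2, and the last keeps [tup] >= 1. *)
pose B := `|ln c| / eta + 2 * c / eta + 1.
have lnc0 : 0 <= `|ln c| / eta by rewrite divr_ge0// ltW.
have ce0 : 0 < 2 * c / eta by rewrite divr_gt0// mulr_gt0.
near=> n.
have n0 : (0 : R) < n%:R by rewrite ltr0n; near: n; exact: nbhs_infty_gt.
have q0 : (0 : R) < (q n)%:R by rewrite ltr0n.
have q1 : (1 : R) <= (q n)%:R by rewrite ler1n.
have qn2 : 2 * (q n)%:R <= n%:R :> R by near: n; apply: q_le_n.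
have sig : forall tau x : R, 1 / n%:R <= tau ->
    Num.sqrt (2 * ln n%:R) + eta / 2 <= `|x| ->
    C <= x ^+ 2 /\ C * x ^+ 2 <= tau * expR (x ^+ 2 / 2).
  by near: n; exact: signal_threshold.
have sq : Num.sqrt (2 * ln n%:R) <= mn n + eta / 2.
  by near: n; apply: (sqrt_ln_n q_gt0 delta_gt1 q_rate).
have lnq : B ^+ 2 + `|ln c| <= ln (n%:R / (q n)%:R) by near: n; apply: ln_n_q.
have lne : expR 1 ^+ 2 <= ln n%:R :> R by near: n; exact: cvgn_ln.
have ql : 2 * ln n%:R <= (q n)%:R :> R by near: n; apply: (ln_le_q delta_gt1 q_rate).
have ne : (eta / 2)^-1 <= n%:R :> R by near: n; exact: nbhs_infty_ger.
pose tup := Num.sqrt (2 * ln (n%:R / (c * (q n)%:R))).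
have lnE : ln (n%:R / (c * (q n)%:R)) = ln (n%:R / (q n)%:R) - ln c.
  by rewrite !ln_div ?lnM ?posrE ?mulr_gt0//; lra.
have lnc := ler_norm (ln c).
have lnB : B ^+ 2 <= ln (n%:R / (c * (q n)%:R)) by rewrite lnE; lra.
have B1 : 1 <= B by rewrite /B; lra.
have BB : 0 <= B ^+ 2 by exact: sqr_ge0.
have tup2 : tup ^+ 2 = 2 * ln (n%:R / (c * (q n)%:R)) by rewrite sqr_sqrtr//; lra.
have tup0 : 0 <= tup by exact: sqrtr_ge0.
have tupB : B <= tup.
  by rewrite -(@ler_pXn2r _ 2%N) ?nnegrE// ?tup2; lra.
have tupp : 0 < tup by lra.
have cqn : 0 < n%:R / (c * (q n)%:R) by rewrite divr_gt0// mulr_gt0.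
have EtupE : expR (tup ^+ 2 / 2) = n%:R / (c * (q n)%:R).
  have -> : tup ^+ 2 / 2 = ln (n%:R / (c * (q n)%:R)) by rewrite tup2; field.
  by rewrite lnK.
(* The third witness is exp (-[tup]^2/2) / [tup], the two-sided Gaussian tail bound; the fourth,
   n^(-2), stays negligible after multiplication by n. *)
exists (Num.sqrt (2 * ln n%:R) + eta / 2), tup, (c * (q n)%:R / n%:R / tup), (n%:R ^- 2).
split.
- move=> tau x /andP[ntau tau1] /(sig _ _ ntau)[Cx Ctau].
  apply: lower => //; rewrite tau1 andbT; apply: lt_le_trans ntau.
  exact: divr_gt0.
- move=> tau x /andP[ntau tauq] xtup.
  have tau0 : 0 < tau by apply: lt_le_trans ntau; exact: divr_gt0.
  have tau1 : tau <= 1.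
    by apply: le_trans tauq _; rewrite ler_pdivrMr// mul1r natrM.
  apply: (le_trans (upper tau x _)); first by rewrite tau0.
  have Ex : expR (x ^+ 2 / 2) <= n%:R / (c * (q n)%:R).
    rewrite -EtupE ler_expR ler_pM2r// -[x ^+ 2]real_normK ?num_real//.
    by rewrite ler_pXn2r ?nnegrE.
  apply: (@le_trans _ _ (C0 * ((2 * q n)%:R / n%:R) * (n%:R / (c * (q n)%:R)))).
    apply: ler_pM => //; rewrite ?expR_ge0//.
      by rewrite mulr_ge0// ltW.
    by rewrite ler_pM2l.
  rewrite le_eqVlt; apply/orP; left; apply/eqP; rewrite /c natrM; field.
  by rewrite (gt_eqF n0) (gt_eqF q0) (gt_eqF C00).
- apply: le_trans (normal_prob_abs_tail tupp) _; rewrite lee_fin.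
  by rewrite ler_pM2r ?invr_gt0// expRN EtupE invf_div.
- have l0 : 0 < ln n%:R :> R by apply: lt_le_trans lne; rewrite exprn_gt0 ?expR_gt0.
  (* As c1 >= 2, the cutoff is at least r, where the tail bound is 1/(n r). Thus n p = 1/r <= exp
     (-1), and its power q + 1 is at most n^(-2) because q >= 2 ln n. *)
  pose r : R := Num.sqrt (2 * ln n%:R).
  have r0 : 0 < r by rewrite sqrtr_gt0 mulr_gt0.
  have r2 : r ^+ 2 = 2 * ln n%:R by rewrite sqr_sqrtr// mulr_ge0// ltW.
  exists (n%:R^-1 / r).
    apply: (@le_trans _ _ (np [set x : R | (r < `|x|)%R])).
      apply: le_measure; rewrite ?inE; [exact: measurable_abs_gt..|].
      move=> x /=; apply: le_lt_trans; rewrite ler_sqrt ?ler_pM2r//.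
      by rewrite mulr_ge0 ?(ltW l0)// (le_trans _ c1_ge2).
    apply: le_trans (normal_prob_abs_tail r0) _; rewrite lee_fin.
    have -> : r ^+ 2 / 2 = ln n%:R by rewrite r2; field.
    by rewrite expRN lnK ?posrE.
  rewrite mulrA divff ?gt_eqF// div1r.
  apply: (@le_trans _ _ (expR (- 1) ^+ (q n).+1)).
    rewrite lerXn2r ?nnegrE ?expR_ge0 ?invr_ge0 ?(ltW r0)//.
    rewrite expRN lef_pV2 ?posrE ?expR_gt0//.
    rewrite -(@ler_pXn2r _ 2%N) ?nnegrE ?expR_ge0 ?(ltW r0)// r2; lra.
  rewrite -expRM_natl mulrN1.
  have -> : n%:R ^- 2 = expR (- (2 * ln n%:R)) :> R.
    by rewrite expRN expRM_natl lnK ?posrE.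
  by rewrite ler_expR lerN2 -natr1; lra.
- by rewrite /=; lra.
- rewrite lerBlDr.
  rewrite -[leRHS]ger0_norm ?addr_ge0 ?(ltW eta0)// -sqrtr_sqr ler_sqrt ?sqr_ge0//.
  (* The square of the beta-min level is [tup]^2 + 2 ln c, which is then at most ([tup] + eta)^2. *)
  have : `|ln c| <= eta * tup.
    rewrite -ler_pdivrMl// mulrC; apply: le_trans tupB.
    by rewrite /B; lra.
  have -> : 2 * ln (n%:R / (q n)%:R) = tup ^+ 2 + 2 * ln c by rewrite tup2 lnE; ring.
  rewrite sqrrD -[tup * eta *+ 2]mulr_natl; have := sqr_ge0 eta; lra.
- rewrite mulrDr.
  have -> : n%:R * (c * (q n)%:R / n%:R / tup) = c / tup * (q n)%:R.
    by field; rewrite (gt_eqF n0) (gt_eqF tupp).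
  have -> : n%:R * n%:R ^- 2 = n%:R^-1 :> R.
    by rewrite expr2 invfM mulrA divff ?mul1r// gt_eqF.
  have h1 : c / tup <= eta / 2.
    rewrite ler_pdivrMr// mulrC -ler_pdivrMr//.
    by apply: le_trans tupB; rewrite /B invfM invrK; lra.
  have h2 : n%:R^-1 <= eta / 2 by rewrite -[leRHS]invrK lef_pV2 ?posrE ?invr_gt0.
  have h3 : c / tup * (q n)%:R <= eta / 2 * (q n)%:R by rewrite ler_pM2r.
  have h4 : eta / 2 <= eta / 2 * (q n)%:R by rewrite ler_peMr// ltW.
  lra.
Unshelve. all: by end_near. Qed.

Variables (d : nat -> measure_display) (T : forall n, measurableType (d n)).
Variables (P : forall n, probability (T n) R).
Variable eps : forall n, 'I_n -> {RV (P n) >-> R}.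
Arguments eps : clear implicits.
Hypothesis eps_indep : forall n, mutually_independent (eps n).
Hypothesis eps_normal : forall n i, standard_normal (eps n i).

Let risk (n : nat) (b : R) : \bar R :=
  (((q n)%:R^-1)%:E *
   max_risk (eps n) (eb_rule (1 / 2) L c1 c2) (beta_min (q n) b))%E.

Let risk_le (n : nat) (b r : R) :
  (forall theta : 'rV[R]_n, beta_min (q n) b theta ->
    ('E_(P n)[fun w => (hamming_loss theta (eb_rule (1 / 2) L c1 c2
       (observation theta (eps n) w)))%:R] <= ((q n)%:R * r)%:E)%E) ->
  (risk n b <= r%:E)%E.
Proof.
move=> h; rewrite /risk muleC lee_pdivrMr ?ltr0n//.
by apply: ge_ereal_sup => _ [theta thb <-]; rewrite -EFinM [r * _]mulrC; exact: h.
Qed.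

Let risk_ge (n : nat) (b r : R) (theta : 'rV[R]_n) :
  beta_min (q n) b theta ->
  (((q n)%:R * r)%:E <= 'E_(P n)[fun w => (hamming_loss theta
     (eb_rule (1 / 2) L c1 c2 (observation theta (eps n) w)))%:R])%E ->
  (r%:E <= risk n b)%E.
Proof.
move=> thb h; rewrite /risk muleC lee_pdivlMr ?ltr0n//.
rewrite -EFinM [r * _]mulrC; apply: le_trans h _.
by apply: ereal_sup_ubound; exists theta.
Qed.

Let exceed_le (n : nat) (eta tlo tup v g : R) :
  thresholds eta n tlo tup v g ->
  (P n (many_exceed (eps n) (Num.sqrt (c1 * ln n%:R)) (q n)) <= g%:E)%E.
Proof.
move=> [_ _ _ [p hp pg] _ _ _].
apply: (le_trans (many_exceed_prob (@eps_indep n) (@eps_normal n) (q n) hp)).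
by rewrite lee_fin.
Qed.

(** The sample size from which the bound holds does not depend on b, so it also applies along a
    sequence b_n. One half of eta pays for the shift of [Phi], the other for false positives and the
    exceptional event. *)
Lemma risk_upper (eta : R) : 0 < eta ->
  \forall n \near \oo, forall b : R, (risk n b <= (1 - Phi b + eta)%:E)%E.
Proof.
move=> eta0; have e20 : 0 < eta / 2 by rewrite divr_gt0.
near=> n => b.
have n0 : (0 < n)%N by near: n; exact: nbhs_infty_gt.
have [tlo [tup [v [g h]]]] : exists tlo tup v g, thresholds (eta / 2) n tlo tup v g.
  by near: n; exact: exists_thresholds.
have Pg := exceed_le h; have [rej acc tl _ lo _ sm] := h.
apply: risk_le => theta [thq thb].
apply: (le_trans (expected_loss_le (@eps_normal n) n0 (q_gt0 n) c2_ge1 rej acc tl Pg thq thb)).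
rewrite lee_fin.
have : Phi (tlo - (mn n + b)) <= Phi (- b) + eta / 2.
  by apply: le_trans (Phi_shift _ (ltW e20)); apply: Phi_mono; lra.
rewrite PhiN => /(ler_wpM2l (ler0n R (q n))); lra.
Unshelve. all: by end_near. Qed.

(** Tested on the vector whose q signals all sit exactly at the beta-min level. *)
Lemma risk_lower (b eta : R) : 0 < eta ->
  \forall n \near \oo, ((1 - Phi b - eta)%:E <= risk n b)%E.
Proof.
move=> eta0; have e20 : 0 < eta / 2 by rewrite divr_gt0.
near=> n.
have n0 : (0 < n)%N by near: n; exact: nbhs_infty_gt.
have n0' : (0 : R) < n%:R by rewrite ltr0n.
have [tlo [tup [v [g h]]]] : exists tlo tup v g, thresholds (eta / 2) n tlo tup v g.
  by near: n; exact: exists_thresholds.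
have Pg := exceed_le h; have [rej acc tl _ _ up sm] := h.
have qn : (q n <= n)%N.
  rewrite -(ler_nat R) -[leLHS]mul1r; near: n; exact: q_le_n.
(* This makes the level plus b positive, so the signals are nonzero; how large n must be depends on
   b. *)
have lb : (`|b| + 1) ^+ 2 <= ln (n%:R / (q n)%:R) by near: n; exact: ln_n_q.
have mb : `|b| + 1 <= mn n.
  rewrite -[leLHS]ger0_norm ?addr_ge0// -sqrtr_sqr ler_sqrt; last first.
    by rewrite mulr_ge0// (le_trans _ lb) ?sqr_ge0.
  by have := sqr_ge0 (`|b| + 1); lra.
have m0 : 0 < mn n + b by have := ler_norm (- b); rewrite normrN; lra.
have thq := card_sparse_vector qn (lt0r_neq0 m0).
have thE := @sparse_vectorE R n (q n) (mn n + b) (lt0r_neq0 m0).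
apply: (risk_ge (theta := sparse_vector n (q n) (mn n + b))).
  by split=> // i /thE ->; exact: ler_norm.
apply: (le_trans _ (expected_loss_ge (@eps_normal n) n0 (q_gt0 n) c2_ge1 acc tl Pg m0 thq thE)).
rewrite lee_fin ler_wpM2l//.
have vg : v + g <= eta / 2.
  rewrite -(ler_pM2l n0'); apply: le_trans sm _.
  by rewrite mulrC ler_pM2r// ler_nat.
have : Phi (- b) <= Phi (tup - (mn n + b)) + eta / 2.
  by apply: le_trans (Phi_shift _ (ltW e20)); apply: Phi_mono; lra.
rewrite PhiN; lra.
Unshelve. all: by end_near. Qed.

(** The class must be shown nonempty, since the supremum of the empty set is -oo. Unlike
    [risk_lower], this is uniform in b. *)
Lemma risk_ge0 : \forall n \near \oo, forall b : R, (0 <= risk n b)%E.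
Proof.
near=> n => b.
have qn : (q n <= n)%N.
  rewrite -(ler_nat R) -[leLHS]mul1r; near: n; exact: q_le_n.
(* A signal that is nonzero and above the required level whatever the sign of that level. *)
have m0 : 0 < `|mn n + b| + 1 by rewrite ltr_wpDl.
apply: (risk_ge (theta := sparse_vector n (q n) (`|mn n + b| + 1))).
  split; first exact: card_sparse_vector qn (lt0r_neq0 m0).
  move=> i /(sparse_vectorE (lt0r_neq0 m0)) ->.
  by have := ler_norm (mn n + b); rewrite (ger0_norm (ltW m0)); lra.
rewrite mulr0; apply: expectation_ge0 => w; exact: ler0n.
Unshelve. all: by end_near. Qed.

Lemma risk_cvg (b : R) : (risk n b - (1 - Phi b)%:E)%E @[n --> \oo] --> 0%E.
Proof.
apply: cvge0_squeeze => e e0.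
apply: filterS2 (risk_upper e0) (risk_lower b e0) => n /(_ b) u l.
by rewrite leeBrDr// leeBlDr// -!EFinD addrC l addrC u.
Qed.

Lemma risk_cvgy (b : R^nat) : b n @[n --> \oo] --> +oo ->
  (risk n (b n) - (1 - Phi (b n))%:E)%E @[n --> \oo] --> 0%E.
Proof.
move=> /cvgryPge bo; apply: cvge0_squeeze => e e0.
(* Once b_n >= 1/e, Mills' inequality gives 1 - Phi (b_n) <= 1/(2 b_n) <= e, so nonnegativity of the
   risk is already a sufficient lower bound. *)
apply: filterS3 (risk_upper e0) risk_ge0 (bo e^-1) => n /(_ (b n)) u /(_ (b n)) l be.
have b0 : 0 < b n by rewrite (lt_le_trans _ be)// invr_gt0.
have Pe : 1 - Phi (b n) <= e.
  rewrite -PhiN; apply: le_trans (Phi_tail b0) _.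
  have h : expR (- (b n ^+ 2 / 2)) <= 1.
    by rewrite expR_le1 oppr_le0 divr_ge0 ?sqr_ge0.
  rewrite ler_pdivrMr ?mulr_gt0//; apply: (le_trans h).
  have := ler_wpM2l (ltW e0) be; rewrite divff ?gt_eqF//; lra.
rewrite leeBrDr// leeBlDr// -!EFinD; apply/andP; split.
  by apply: le_trans l; rewrite lee_fin; lra.
by rewrite addrC.
Qed.

End MainResult.

Theorem theorem2 (R : realType)
  (q : nat -> nat) (delta2 : R)
  (q_gt0 : forall n, (0 < q n)%N)
  (q_sparse : (q n)%:R / n%:R @[n --> \oo] --> (0 : R))
  (delta2_gt1 : 1 < delta2)
  (q_rate : asymp (fun n => (q n)%:R) (fun n => ln n%:R `^ delta2))
  (K : R) (L : R -> R)
  (prior : one_group_prior K (1 / 2) L)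
  (A1 : exists c0 t0 : R,
          [/\ 0 < c0, 0 < t0 & forall t, t0 <= t -> c0 <= L t])
  (A2 : exists M : R, 0 < M /\ forall t, 0 < t -> L t <= M)
  (c1 c2 : R) (c1_ge2 : 2 <= c1) (c2_ge1 : 1 <= c2)
  (d : nat -> measure_display) (T : forall n, measurableType (d n))
  (P : forall n, probability (T n) R)
  (eps : forall n, 'I_n -> {RV (P n) >-> R})
  (eps_indep : forall n, mutually_independent (eps n))
  (eps_normal : forall n i, standard_normal (eps n i)) :
  let normalized_risk (n : nat) (b : R) : \bar R :=
    (((q n)%:R^-1)%:E *
     max_risk (eps n) (eb_rule (1 / 2) L c1 c2) (beta_min (q n) b))%E in
  (forall b : R,
     (normalized_risk n b - (1 - Phi b)%:E)%E @[n --> \oo] --> 0%E) /\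
  (forall b : R^nat, b n @[n --> \oo] --> +oo ->
     (normalized_risk n (b n) - (1 - Phi (b n))%:E)%E @[n --> \oo] --> 0%E).
Proof.
by move=> normalized_risk; split=> b;
  [exact: (risk_cvg q_gt0 q_sparse delta2_gt1 q_rate prior)
  |exact: (risk_cvgy q_gt0 q_sparse delta2_gt1 q_rate prior)].
Qed.
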